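(* Let $p$ be an odd prime, let $G$ be a non-abelian $p$-group of order $p^4$ of nilpotency class $3$, and let $H$ be its unique abelian subgroup of index $p$. Let $m$ and $m'$ denote the exponents of $H$ and $H/G'$, respectively. Then the Wedderburn decomposition of $\mathbb{Q}G$ is $$\mathbb{Q}G\cong\mathbb{Q}(G/G')\ \oplus\bigoplus_{d\mid m,\ d \nmid m'} \frac{a_{d}}{p}M_p(\mathbb{Q}(\zeta_{d}))\ \oplus\bigoplus_{d\mid m,\ d\mid m'}\frac{a_{d}-a_{d}'}{p}M_p(\mathbb{Q}(\zeta_{d})),$$ where $a_{d}$ and $a_{d}'$ are the numbers of cyclic subgroups of order $d$ of $H$ and of $H/G'$, respectively.
   Context: $G'$ is the commutator subgroup of $G$. A group of order $p^4$ and nilpotency class $3$ has exactly one abelian subgroup of index $p$, and this subgroup contains $G'$. $\mathbb{Q}(G/G')$ is the rational group algebra of $G/G'$, $\zeta_d$ is a primitive $d$-th root of unity, $M_p(D)$ is the ring of $p\times p$ matrices over $D$, and for an integer $a\ge 0$, $aR$ denotes the direct sum of $a$ copies of the algebra $R$. *)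

(* Defs.v *)
From HB Require Import structures.
From mathcomp Require Import all_boot all_order all_fingroup all_algebra.
From mathcomp Require Import all_solvable all_field.

Set Implicit Arguments.
Unset Strict Implicit.
Unset Printing Implicit Defensive.

Import GroupScope GRing.Theory.
Local Open Scope ring_scope.

Definition alg_isomorphic (R : pzRingType) (A B : algType R) : Prop :=
  exists f : {lrmorphism A -> B}, bijective f.

(* The library's algType excludes the zero ring, which is the direct sum of the
   empty family; so the direct sum of an arbitrary finite family is only made a
   ring and a module, and becomes an algebra once a nonzero algebra is added. *)
Definition dirsum (R : pzRingType) (I : finType) (A : I -> algType R) :=
  {dffun forall i, A i}.

Section DirectSum.
Variables (R : pzRingType) (I : finType) (A : I -> algType R).
Local Notation S := (dirsum A).
Implicit Types (x y z : S) (k : R).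

HB.instance Definition _ := Choice.on S.

Let zero : S := [ffun => 0].
Let one : S := [ffun => 1].
Let opp x : S := [ffun i => - x i].
Let add x y : S := [ffun i => x i + y i].
Let mul x y : S := [ffun i => x i * y i].
Let scale k x : S := [ffun i => k *: x i].

Fact dirsum_addA : associative add.
Proof. by move=> x y z; apply/ffunP => i; rewrite !ffunE addrA. Qed.
Fact dirsum_addC : commutative add.
Proof. by move=> x y; apply/ffunP => i; rewrite !ffunE addrC. Qed.
Fact dirsum_add0 : left_id zero add.
Proof. by move=> x; apply/ffunP => i; rewrite !ffunE add0r. Qed.
Fact dirsum_addN : left_inverse zero opp add.
Proof. by move=> x; apply/ffunP => i; rewrite !ffunE addNr. Qed.

HB.instance Definition _ := GRing.isZmodule.Build S
  dirsum_addA dirsum_addC dirsum_add0 dirsum_addN.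

Fact dirsum_mulA : associative mul.
Proof. by move=> x y z; apply/ffunP => i; rewrite !ffunE mulrA. Qed.
Fact dirsum_mul1l : left_id one mul.
Proof. by move=> x; apply/ffunP => i; rewrite !ffunE mul1r. Qed.
Fact dirsum_mul1r : right_id one mul.
Proof. by move=> x; apply/ffunP => i; rewrite !ffunE mulr1. Qed.
Fact dirsum_mulDl : left_distributive mul add.
Proof. by move=> x y z; apply/ffunP => i; rewrite !ffunE mulrDl. Qed.
Fact dirsum_mulDr : right_distributive mul add.
Proof. by move=> x y z; apply/ffunP => i; rewrite !ffunE mulrDr. Qed.

HB.instance Definition _ := GRing.Zmodule_isPzRing.Build S
  dirsum_mulA dirsum_mul1l dirsum_mul1r dirsum_mulDl dirsum_mulDr.

Fact dirsum_scaleA k l x : scale k (scale l x) = scale (k * l) x.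
Proof. by apply/ffunP => i; rewrite !ffunE scalerA. Qed.
Fact dirsum_scale1 : left_id 1 scale.
Proof. by move=> x; apply/ffunP => i; rewrite !ffunE scale1r. Qed.
Fact dirsum_scaleDr : right_distributive scale add.
Proof. by move=> k x y; apply/ffunP => i; rewrite !ffunE scalerDr. Qed.
Fact dirsum_scaleDl x : {morph scale^~ x : k l / k + l >-> add k l}.
Proof. by move=> k l; apply/ffunP => i; rewrite !ffunE scalerDl. Qed.

HB.instance Definition _ := GRing.Zmodule_isLmodule.Build R S
  dirsum_scaleA dirsum_scale1 dirsum_scaleDr dirsum_scaleDl.

End DirectSum.

Definition oplus (R : pzRingType) (B : algType R) (I : finType)
    (A : I -> algType R) :=
  (B * dirsum A)%type.

Section OPlus.
Variables (R : pzRingType) (B : algType R) (I : finType) (A : I -> algType R).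
Local Notation S := (oplus B A).
Implicit Types (x y : S) (k : R).

HB.instance Definition _ := GRing.PzRing.on S.
HB.instance Definition _ := GRing.Lmodule.on S.

Fact oplus_one_neq0 : 1 != 0 :> S.
Proof. by apply/eqP => -[/eqP]; rewrite oner_eq0. Qed.

HB.instance Definition _ := GRing.PzSemiRing_isNonZero.Build S oplus_one_neq0.

Fact oplus_scaleAl k x y : k *: (x * y) = k *: x * y.
Proof.
congr (_, _); first exact: scalerAl.
by apply/ffunP => i; rewrite !ffunE scalerAl.
Qed.
Fact oplus_scaleAr k x y : k *: (x * y) = x * (k *: y).
Proof.
congr (_, _); first exact: scalerAr.
by apply/ffunP => i; rewrite !ffunE scalerAr.
Qed.

HB.instance Definition _ := GRing.Lmodule_isLalgebra.Build R S oplus_scaleAl.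
HB.instance Definition _ := GRing.Lalgebra_isAlgebra.Build R S oplus_scaleAr.

End OPlus.

(* The c d copies of A d, for d in s, are indexed by the pairs (d, j), j < c d. *)
Definition oplus_copies (R : pzRingType) (B : algType R) (s : seq nat)
    (c : nat -> nat) (A : nat -> algType R) : algType R :=
  oplus B (fun i : {d : seq_sub s & 'I_(c (ssval d))} => A (ssval (tag i))).

(* The n x n matrices over A as an algebra over the base ring R of A; the scalars
   of the library's 'M[A]_n are those of A, hence the alias. As for {'GL_n[R]},
   n is written n.-1.+1 because the library only makes 'M_n.+1 a nonzero ring;
   the definition is only meaningful for 0 < n. *)
Definition mxalg (R : pzRingType) (A : algType R) (n : nat) :=
  'M[A]_n.-1.+1.

Section MatrixAlgebra.
Variables (R : pzRingType) (A : algType R) (n : nat).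
Local Notation M := (mxalg A n).
Implicit Types (x y : M) (k : R).

HB.instance Definition _ := GRing.NzRing.on M.

Let scale k x : M := map_mx (fun c : A => k *: c) x.

Fact mxalg_scaleA k l x : scale k (scale l x) = scale (k * l) x.
Proof. by apply/matrixP => i j; rewrite !mxE scalerA. Qed.
Fact mxalg_scale1 : left_id 1 scale.
Proof. by move=> x; apply/matrixP => i j; rewrite !mxE scale1r. Qed.
Fact mxalg_scaleDr : right_distributive scale +%R.
Proof. by move=> k x y; apply/matrixP => i j; rewrite !mxE scalerDr. Qed.
Fact mxalg_scaleDl x : {morph scale^~ x : k l / k + l}.
Proof. by move=> k l; apply/matrixP => i j; rewrite !mxE scalerDl. Qed.

HB.instance Definition _ := GRing.Zmodule_isLmodule.Build R M
  mxalg_scaleA mxalg_scale1 mxalg_scaleDr mxalg_scaleDl.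

Fact mxalg_scaleAl k x y : k *: (x * y) = k *: x * y.
Proof.
apply/matrixP => i j; rewrite !mxE scaler_sumr.
by apply: eq_bigr => l _; rewrite mxE scalerAl.
Qed.
Fact mxalg_scaleAr k x y : k *: (x * y) = x * (k *: y).
Proof.
apply/matrixP => i j; rewrite !mxE scaler_sumr.
by apply: eq_bigr => l _; rewrite mxE scalerAr.
Qed.

HB.instance Definition _ := GRing.Lmodule_isLalgebra.Build R M mxalg_scaleAl.
HB.instance Definition _ := GRing.Lalgebra_isAlgebra.Build R M mxalg_scaleAr.

End MatrixAlgebra.

(* The function u stands for the formal sum of the u x *: x; the product is
   convolution. *)
Definition group_alg (R : comNzRingType) (gT : finGroupType) :=
  {ffun gT -> R^o}.

Section GroupAlgebra.
Variables (R : comNzRingType) (gT : finGroupType).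
Local Notation RG := (group_alg R gT).
Implicit Types (u v w : RG) (k : R).

HB.instance Definition _ := GRing.Lmodule.on RG.

Let one : RG := [ffun x => (x == 1%g)%:R].
Let mul u v : RG := [ffun x => \sum_y (u y : R) * v (y^-1 * x)%g].

Fact group_alg_mulA : associative mul.
Proof.
move=> u v w; apply/ffunP => x; rewrite !ffunE.
under eq_bigr => y _.
  rewrite ffunE big_distrr /=.
  rewrite (reindex_inj (mulgI y^-1)%g) /=.
  under eq_bigr => z _ do rewrite invMg invgK -!mulgA mulKVg mulrA.
  over.
rewrite exchange_big /=; apply: eq_bigr => z _.
by rewrite ffunE big_distrl.
Qed.
Fact group_alg_mul1l : left_id one mul.
Proof.
move=> u; apply/ffunP => x; rewrite ffunE (bigD1 1%g) //= ffunE eqxx mul1r.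
rewrite invg1 mul1g big1 ?addr0 // => y /negPf y1.
by rewrite ffunE y1 mul0r.
Qed.
Fact group_alg_mul1r : right_id one mul.
Proof.
move=> u; apply/ffunP => x; rewrite ffunE (bigD1 x) //= ffunE mulVg eqxx mulr1.
rewrite big1 ?addr0 // => y yx.
by rewrite ffunE -eq_mulVg1 (negPf yx) mulr0.
Qed.
Fact group_alg_mulDl : left_distributive mul +%R.
Proof.
move=> u v w; apply/ffunP => x; rewrite !ffunE -big_split /=.
by apply: eq_bigr => y _; rewrite ffunE mulrDl.
Qed.
Fact group_alg_mulDr : right_distributive mul +%R.
Proof.
move=> u v w; apply/ffunP => x; rewrite !ffunE -big_split /=.
by apply: eq_bigr => y _; rewrite ffunE mulrDr.
Qed.
Fact group_alg_one_neq0 : one != 0.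
Proof.
by apply/eqP => /ffunP/(_ 1%g)/eqP; rewrite !ffunE eqxx oner_eq0.
Qed.

HB.instance Definition _ := GRing.Zmodule_isNzRing.Build RG
  group_alg_mulA group_alg_mul1l group_alg_mul1r group_alg_mulDl
  group_alg_mulDr group_alg_one_neq0.

Fact group_alg_scaleAl k u v : k *: (u * v) = k *: u * v.
Proof.
apply/ffunP => x; rewrite !ffunE scaler_sumr.
by apply: eq_bigr => y _; rewrite ffunE scalerAl.
Qed.
Fact group_alg_scaleAr k u v : k *: (u * v) = u * (k *: v).
Proof.
apply/ffunP => x; rewrite !ffunE scaler_sumr.
by apply: eq_bigr => y _; rewrite ffunE [LHS]mulrCA.
Qed.

HB.instance Definition _ := GRing.Lmodule_isLalgebra.Build R RG
  group_alg_scaleAl.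
HB.instance Definition _ := GRing.Lalgebra_isAlgebra.Build R RG
  group_alg_scaleAr.

End GroupAlgebra.

(* As in the library's definition of 'Phi_n, writing n.-1.+1 for n makes the
   definition total; it is only meaningful for 0 < n. *)
Definition zeta (n : nat) : algC := sval (C_prim_root_exists (ltn0Sn n.-1)).

(* num_field_exists s provides the subfield of algC generated by s over the
   rationals, as an abstract extension together with its embedding in algC. *)
Definition Qzeta (n : nat) : fieldExtType rat :=
  tag (num_field_exists [:: zeta n]).

Definition num_cyclic (gT : finGroupType) (H : {group gT}) (d : nat) : nat :=
  #|[set C : {group gT} | [&& C \subset H, cyclic C & #|C| == d]]|.

(* Main.v *)
Require Import Defs.
From HB Require Import structures.
From mathcomp Require Import all_boot all_order all_fingroup all_algebra.
From mathcomp Require Import all_solvable all_field all_character.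

Set Implicit Arguments.
Unset Strict Implicit.
Unset Printing Implicit Defensive.

(** Write N for the commutator subgroup of G.  An irreducible rational
    representation of the abelian group H is determined by its kernel K, a
    subgroup with H / K cyclic of some order d: it is the map H -> Q(zeta_d)
    sending a generator of H / K to zeta_d.  Inducing it to G gives an algebra
    map from QG to the p x p matrices over Q(zeta_d), with monomial images, and
    the decomposition consists of these maps, one for each G-class of kernels K
    that do not contain N, together with the quotient map to Q(G/N).

    The step special to the groups at hand is [der1_sub_normal]: a kernel K that
    is normal in G contains N.  So the kernels that do not contain N are moved
    by every element of G outside H, and fall into G-classes of p elements each;
    for p = 2 this fails, for instance in the dihedral group of order 16.  It is
    derived from the fact that N has exponent p ([exponent_der1]), which comes
    from expanding the action of the p-th power of an element of G, an element
    of H, by the binomial formula.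

    Surjectivity is a Chinese remainder argument.  A product of elements 1 - k
    and of sums over subgroups gives an element of QH that is killed by all the
    characters of H but those of kernel K, and by the map to Q(H/N)
    ([kernel_isolator]).  Since the conjugates of K by elements outside H differ
    from K, its image under the representation induced from K has a single
    nonzero entry, on the diagonal, and translating it by coset representatives
    on both sides yields all the matrix units ([ind_lift_isolate]).

    Injectivity is tested on the complex characters of H.  One of kernel K is a
    Galois conjugate of the map H -> Q(zeta_d) above, so that both vanish on the
    same elements of QH ([ker_char_lift_irr]); an element u of QG killed by all
    the components is thus killed, after any translation, by every irreducible
    character of H extended by zero, and the regular character of H then shows
    that its coefficients are zero ([ind_lift_inj]).

    The multiplicities are counted by duality: H has as many subgroups K with
    H / K cyclic of order d as it has cyclic subgroups of order d
    ([num_cocyclicE]), and those that contain N correspond to the same for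
    H / N.  This leaves a_d - a'_d kernels, in (a_d - a'_d) / p classes. *)

(** * Kernels with cyclic quotient that are normal in G *)

Section NormalKernels.
Import GroupScope.

Variables (p : nat) (gT : finGroupType) (G H : {group gT}).
Hypotheses (p_prime : prime p) (p_odd : odd p) (pG : p.-group G).
Hypotheses (oG : #|G| = (p ^ 4)%N) (clG : nil_class G = 3).
Hypotheses (sHG : H \subset G) (abH : abelian H) (iH : #|G : H| = p).

Lemma max_normal : H <| G.
Proof.
have maxH : maximal H G by apply: p_index_maximal => //; rewrite iH.
exact: p_maximal_normal pG maxH.
Qed.

Lemma cyclic_quo_max : cyclic (G / H).
Proof.
apply: prime_cyclic.
by rewrite card_quotient ?normal_norm ?max_normal // iH.
Qed.

Lemma der1_sub_max : G^`(1) \subset H.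
Proof.
by rewrite der1_min ?normal_norm ?max_normal // cyclic_abelian ?cyclic_quo_max.
Qed.

Lemma expp_in_max x : x \in G -> x ^+ p \in H.
Proof.
move=> Gx; have nHx := subsetP (normal_norm max_normal) x Gx.
apply: coset_idr; first exact: groupX.
rewrite morphX //; apply/eqP; rewrite -order_dvdn.
have := order_dvdG (mem_quotient H Gx).
by rewrite card_quotient ?normal_norm ?max_normal // iH.
Qed.

(** Modulo [~: H, G] the subgroup H is central with cyclic quotient, so that
    the quotient of G is abelian. *)
Lemma der1_comm_max : G^`(1) = [~: H, G].
Proof.
have nHG := normal_norm max_normal.
apply/eqP; rewrite eqEsubset (commSg _ sHG) andbT.
rewrite der1_min ?commg_normr //.
apply: cyclic_center_factor_abelian.
set K := [~: H, G].
have sKH : K \subset H by rewrite commg_subl.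
have nKG : K <| G by rewrite /normal (subset_trans sKH sHG) commg_normr.
have sHZ : H / K \subset 'Z(G / K).
  by rewrite subsetI quotientS //= quotient_cents2r.
have cyc : cyclic (G / K / (H / K)).
  by rewrite (isog_cyclic (third_isog sKH nKG max_normal)) cyclic_quo_max.
rewrite -(isog_cyclic (third_isog sHZ _ _)) ?center_normal //.
  exact: quotient_cyclic.
by rewrite /normal quotientS //= quotient_norms.
Qed.

Lemma comm_in_max h x : h \in H -> x \in G -> [~ h, x] \in H.
Proof.
move=> Hh Gx; apply: (subsetP der1_sub_max).
by rewrite mem_commg // (subsetP sHG).
Qed.

Lemma commg3_eq1 h x y z : h \in G -> x \in G -> y \in G -> z \in G ->
  [~ h, x, y, z] = 1.
Proof.
move=> Gh Gx Gy Gz; apply/set1gP.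
have /lcn_nil_classP <- : nil_class G <= 3 by rewrite clG.
  by rewrite !lcnSn lcn1 !mem_commg.
exact: pgroup_nil pG.
Qed.

(** As [~ h, x, x] commutes with x, conjugation by x acts on the abelian group H
    as 1 + f where f is h |-> [~ h, x] and f^3 = 0; this is the expansion of
    (1 + f)^n. *)
Lemma conj_expg h x n : h \in H -> x \in G ->
  h ^ (x ^+ n) = h * [~ h, x] ^+ n * [~ h, x, x] ^+ 'C(n, 2).
Proof.
move=> Hh Gx; have Gh := subsetP sHG h Hh.
have Hc := comm_in_max Hh Gx; have Hcc := comm_in_max Hc Gx.
have cH a b : a \in H -> b \in H -> commute a b.
  by move=> Ha Hb; exact: (centsP abH).
elim: n => [|n IHn]; first by rewrite !expg0 !mulg1 conjg1.
rewrite expgSr conjgM IHn !conjMg !conjXg.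
rewrite (conjg_mulR [~ h, x, x]) commg3_eq1 // mulg1.
rewrite (conjg_mulR [~ h, x]) (conjg_mulR h) expgMn; last exact: cH.
by rewrite expgS binS bin1 addnC expgD -!mulgA.
Qed.

(** With n = p in [conj_expg] the left-hand side is h, because x ^+ p lies in
    the abelian group H.  Since p is odd it divides 'C(p, 2), so the identity for
    [~ h, x] in place of h, and then the one for h, give [~ h, x] ^+ p = 1. *)
Lemma exponent_der1 x : x \in G^`(1) -> x ^+ p = 1.
Proof.
have Hcom h y : h \in H -> y \in G ->
    [~ h, y] ^+ p * [~ h, y, y] ^+ 'C(p, 2) = 1.
  move=> Hh Gy; have := conj_expg p Hh Gy.
  rewrite conjgE (centsP abH _ Hh _ (expp_in_max Gy)) mulKg -mulgA.
  by move=> E; apply: (mulgI h); rewrite -E mulg1.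
have [e def_bin] : exists e, 'C(p, 2) = (p * e)%N.
  have /dvdnP[e ->] : p %| 'C(p, 2); last by exists e; rewrite mulnC.
  by apply: prime_dvd_bin => //=; apply: odd_prime_gt2.
have exp1 h y : h \in H -> y \in G -> [~ h, y] ^+ p = 1.
  move=> Hh Gy; have Gh := subsetP sHG h Hh.
  have Hc := comm_in_max Hh Gy.
  have := Hcom _ _ Hc Gy; rewrite commg3_eq1 // expg1n mulg1 => cc1.
  by have := Hcom _ _ Hh Gy; rewrite def_bin expgM cc1 expg1n mulg1.
have sDH := der1_sub_max; rewrite der1_comm_max in sDH.
move: x; apply/exponentP; rewrite der1_comm_max abelian_exponent_gen; last first.
  by rewrite -abelian_gen; exact: abelianS sDH abH.
by apply/exponentP => _ /imset2P[h y Hh Gy ->]; apply: exp1.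
Qed.

(** If G / K has order at most p^2 it is abelian.  Otherwise K has order at most
    p, hence is central, while the cyclic group H / K has order at least p^2, so
    that its elements of order p are p-th powers.  Every x in G^`(1) is then of
    the form k * y ^+ p with k in K and y in H, and commutes with each g since
    [~ y ^+ p, g] = [~ y, g] ^+ p = 1: the class of G would be at most 2. *)
Lemma der1_sub_normal (K : {group gT}) :
  K \subset H -> K <| G -> cyclic (H / K) -> G^`(1) \subset K.
Proof.
move=> sKH nKG /cyclicP[c cycH].
have nKH : H \subset 'N(K) by apply: subset_trans sHG (normal_norm nKG).
have [le2 | gt2] := leqP (logn p #|G / K|) 2.
  rewrite der1_min ?normal_norm //.
  exact: p2group_abelian (quotient_pgroup K pG) le2.
have oK : #|K| %| p.
  have /p_natP[k oK] : p.-nat #|K| by apply: pgroupS pG; apply: normal_sub.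
  move: gt2; rewrite card_quotient ?normal_norm // -divgS ?normal_sub // oG oK.
  have le_k4 : k <= 4.
    by rewrite -(@dvdn_Pexp2l p) ?prime_gt1 // -oK -oG cardSg ?normal_sub.
  rewrite -expnB ?prime_gt0 // pfactorK // => lt2.
  have k_le1 : k <= 1 by move: lt2; clear; case: k => [|[|[|[|[|k]]]]].
  exact: (dvdn_exp2l p k_le1).
have cKG : K \subset 'C(G).
  have [-> | ntK] := eqVneq (K : {set gT}) 1; first exact: sub1G.
  have := meet_center_nil (pgroup_nil pG) nKG ntK.
  have prK : prime #|K|.
    case/primeP: p_prime => _ /(_ _ oK)/orP[] /eqP oK1; last by rewrite oK1.
    by case/eqP: ntK; apply: card1_trivg.
  by move/(prime_meetG prK); rewrite subsetI => /andP[].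
have oHK : p < #[c].
  have : #|G / K| = (p * #[c])%N.
    rewrite orderE -cycH !card_quotient //; last exact: normal_norm.
    by rewrite -iH (Lagrange_index sHG sKH).
  have /p_natP[k def_k] : p.-group (G / K) by rewrite quotient_pgroup.
  move: gt2; rewrite def_k => gt2 def_pc; move: gt2.
  rewrite pfactorK // -(leq_exp2l _ _ (prime_gt1 p_prime)) def_pc expnS -mulnn.
  rewrite leq_pmul2l ?prime_gt0 //; apply: leq_trans.
  by rewrite -[X in X < _]muln1 ltn_pmul2l ?prime_gt1 ?prime_gt0.
apply/negPn/negP => not_sub.
suff : nil_class G <= 2 by rewrite clG.
rewrite nil_class2 subsetI der_sub; apply/subsetP => x Dx; apply/centP => g Gg.
have Hx := subsetP der1_sub_max x Dx; have nKx := subsetP nKH x Hx.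
have /cycleP[i def_x] : coset K x \in <[c]> by rewrite -cycH mem_quotient.
have p_dv_i : p %| i.
  have : #[c] %| i * p.
    by rewrite order_dvdn expgM -def_x -morphX // exponent_der1 // morph1.
  have : p.-elt c.
    by rewrite /p_elt orderE -cycH; exact: quotient_pgroup (pgroupS sHG pG).
  case/p_natP => k oc; rewrite oc in oHK *.
  have k2 : 1 < k.
    by rewrite -(ltn_exp2l _ _ (prime_gt1 p_prime)) expn1.
  move/(dvdn_trans (dvdn_exp2l p k2)).
  by rewrite expnS expn1 dvdn_pmul2r ?prime_gt0.
have [y nKy [Hy def_c]] : exists2 y, y \in 'N(K) & y \in H /\ c = coset K y.
  have /morphimP[y nKy Hy ->] : c \in H / K by rewrite cycH cycle_id.
  by exists y.
case/dvdnP: p_dv_i => j def_i.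
have [|k Kk def_xk] := kercoset_rcoset nKx (groupX (j * p) nKy).
  by rewrite def_x def_i def_c morphX.
have Hyj : y ^+ j \in H by rewrite groupX.
have commute_yj : [~ (y ^+ j) ^+ p, g] = 1.
  rewrite commXg; last exact: (centsP abH) (comm_in_max Hyj Gg).
  by apply: exponent_der1; rewrite mem_commg // (subsetP sHG).
apply/commgP; rewrite def_xk commMgJ expgM commute_yj mulg1.
have /commgP/eqP-> : commute k g by exact: (centsP cKG).
by rewrite conj1g.
Qed.

End NormalKernels.

(** * Duality between cyclic subgroups and cyclic quotients *)

Section Counting.

Lemma card_fibers (S T : finType) (A : {set S}) (B : {set T}) (f : S -> T) n :
    {in A, forall x, f x \in B} ->
    {in B, forall y, #|[set x in A | f x == y]| = n} ->
  #|A| = #|B| * n.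
Proof.
move=> fAB fib; rewrite -sum1_card (partition_big f (mem B)) //=.
rewrite -sum_nat_const; apply: eq_bigr => y By.
by rewrite -(fib y By) -sum1dep_card.
Qed.

Lemma card_dvdn_divisors (S : finType) (A : {pred S}) (f : S -> nat) e :
    0 < e -> {in A, forall x, 0 < f x} ->
  #|[set x in A | f x %| e]|
    = \sum_(d < e.+1 | d %| e) #|[set x in A | f x == d]|.
Proof.
move=> e_gt0 f_gt0.
rewrite -sum1_card.
rewrite (partition_big (fun x => inord (f x) : 'I_e.+1)
  (fun d : 'I_e.+1 => d %| e)) /=.
  apply: eq_bigr => d dv_d; rewrite -sum1_card; apply: eq_bigl => x.
  rewrite !inE -andbA; case: (boolP (x \in A)) => //= Ax.
  apply/andP/eqP => [[fe /eqP <-] | fd].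
    by rewrite inordK // ltnS dvdn_leq.
  by rewrite fd dv_d; split => //; apply/eqP/val_inj; rewrite /= inordK.
move=> x; rewrite inE => /andP[_ fe].
by rewrite inordK // ltnS dvdn_leq.
Qed.

(** Moebius inversion over the divisors of e, in the form of an induction. *)
Lemma eq_card_of_eq_card_dvdn (S T : finType) (A : {pred S}) (B : {pred T})
    (f : S -> nat) (g : T -> nat) :
    {in A, forall x, 0 < f x} -> {in B, forall y, 0 < g y} ->
    (forall e, 0 < e ->
      #|[set x in A | f x %| e]| = #|[set y in B | g y %| e]|) ->
  forall e, 0 < e -> #|[set x in A | f x == e]| = #|[set y in B | g y == e]|.
Proof.
move=> f_gt0 g_gt0 eq_dv e; elim/ltn_ind: e => e IHe e_gt0.
have := eq_dv e e_gt0; rewrite !card_dvdn_divisors //.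
rewrite (bigD1 ord_max) //= [in RHS](bigD1 ord_max) //=.
set s1 := (X in _ + X = _); set s2 := (X in _ = _ + X).
suff -> : s1 = s2 by move/addIn.
apply: eq_bigr => d /andP[dv_d ne_d]; apply: IHe; last exact: dvdn_gt0 dv_d.
have : d <= e by rewrite -ltnS.
by rewrite leq_eqVlt => /orP[/eqP def_d|//]; case/eqP: ne_d; apply: val_inj.
Qed.

End Counting.

Section Duality.
Import GroupScope GRing.Theory.
Local Notation irrk i := (cfker ('chi_i)%R).

Lemma card_irr_ker_ge (gT : finGroupType) (H N : {group gT}) :
  abelian H -> N \subset H -> #|[set i : Iirr H | N \subset irrk i]| = #|H : N|.
Proof.
move=> abH sNH; have nNH : N <| H by rewrite -sub_abelian_normal.
have <- : #|Iirr (H / N)| = #|H : N|.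
  by rewrite card_Iirr_abelian ?quotient_abelian // card_quotient ?normal_norm.
rewrite -(card_imset predT (can_inj (mod_IirrK nNH))).
apply: eq_card => i; rewrite inE.
apply/idP/imsetP => [sN | [j _ ->]].
  by exists (quo_Iirr N i); rewrite // quo_IirrK.
by rewrite mod_IirrE // cfker_mod.
Qed.

(** The center of a character of an abelian group is the whole group. *)
Lemma cyclic_quo_cfker (gT : finGroupType) (H : {group gT}) (i : Iirr H) :
  abelian H -> cyclic (H / irrk i).
Proof.
move=> abH; apply: cyclicS (cfcenter_cyclic ('chi_i)%R); apply: quotientS.
by rewrite -{1}(center_idP abH) -cap_cfcenter_irr bigcap_inf.
Qed.

(** Characters whose order divides e are those trivial on the e-th powers; their
    number is the index of the image of x |-> x ^+ e in H, that is, the order of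
    its kernel. *)
Lemma card_irr_exponent (gT : finGroupType) (H : {group gT}) e : abelian H ->
  #|[set i : Iirr H | #|H : irrk i| %| e]| = #|[set h in H | #[h] %| e]|.
Proof.
move=> abH; pose pow x : gT := x ^+ e.
have powM : {in H &, {morph pow : x y / x * y}}.
  by move=> x y Hx Hy; apply: expgMn; apply: (centsP abH).
pose powm := Morphism powM.
have spH : powm @* H \subset H.
  by apply/subsetP => _ /morphimP[x _ Hx ->]; rewrite /= groupX.
have -> : [set h in H | #[h] %| e] = 'ker powm.
  apply/setP => h; rewrite !inE; case: (boolP (h \in H)) => //= Hh.
  by rewrite order_dvdn.
have -> : #|'ker powm| = #|H : powm @* H|.
  apply/eqP; rewrite -(eqn_pmul2l (cardG_gt0 (powm @* H))) Lagrange //.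
  by rewrite card_morphim setIid mulnC Lagrange // subsetIl.
rewrite -card_irr_ker_ge //; apply: eq_card => i; rewrite !inE.
have nKH := cfker_normal ('chi_i)%R; have nKH' := normal_norm nKH.
rewrite -card_quotient // -exponent_cyclic ?cyclic_quo_cfker //.
apply/exponentP/subsetP => [expe _ /morphimP[x _ Hx ->]
                           | sub _ /morphimP[x nKx Hx ->]].
  apply: coset_idr; first by rewrite (subsetP nKH') ?groupX.
  by rewrite morphX ?(subsetP nKH') //; apply: expe; apply: mem_quotient.
by rewrite -morphX //; apply: coset_id; apply: sub; apply: (@mem_morphim _ _ _ powm).
Qed.

Lemma card_irr_index (gT : finGroupType) (H : {group gT}) d : abelian H ->
  0 < d ->
  #|[set i : Iirr H | #|H : irrk i| == d]| = #|[set h in H | #[h] == d]|.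
Proof.
move=> abH.
apply: (@eq_card_of_eq_card_dvdn _ _ predT (mem H)
  (fun i : Iirr H => #|H : irrk i|) order) => // e _.
exact: card_irr_exponent.
Qed.

Definition num_cocyclic (gT : finGroupType) (H : {group gT}) d :=
  #|[set K : {group gT} | [&& K \subset H, cyclic (H / K) & #|H : K| == d]]|.

Lemma num_cyclic_totient (gT : finGroupType) (H : {group gT}) d :
  #|[set h in H | #[h] == d]| = (num_cyclic H d * totient d)%N.
Proof.
apply: (@card_fibers _ _ _ _ (fun h => <[h]>%G)) => [h | C]; rewrite !inE.
  by case/andP => Hh oh; rewrite cycle_subG Hh cycle_cyclic.
case/and3P => sCH /cyclicP[x defC] /eqP oC.
rewrite -oC defC -orderE totient_gen; apply: eq_card => y.
rewrite !inE -val_eqE /= defC /generator eq_sym.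
apply/andP/eqP => [[_ /eqP] // | defx]; split; last exact/eqP.
by rewrite !orderE -cycle_subG -defx -defC sCH eqxx.
Qed.

(** The characters of kernel K are the faithful ones of the cyclic group H / K;
    by [card_irr_index] there are as many of them as generators of H / K. *)
Lemma num_cocyclic_totient (gT : finGroupType) (H : {group gT}) d :
  abelian H -> 0 < d ->
  #|[set i : Iirr H | #|H : irrk i| == d]| = (num_cocyclic H d * totient d)%N.
Proof.
move=> abH d_gt0.
apply: (@card_fibers _ _ _ _ (fun i => cfker_group ('chi_i)%R)) => [i | K];
  rewrite !inE.
  by move=> -> ; rewrite cfker_sub cyclic_quo_cfker.
case/and3P => sKH cyc /eqP iK; have nKH : K <| H by rewrite -sub_abelian_normal.
have oHK : #|H / K| = d by rewrite card_quotient ?normal_norm.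
have/cyclicP[c defc] := cyc.
have <- : #|[set h in H / K | #[h] == d]| = totient d.
  rewrite -oHK defc -orderE totient_gen; apply: eq_card => y.
  rewrite !inE /generator -cycle_subG.
  apply/andP/eqP => [[sy /eqP oy] | eq_cy].
    by apply/esym/eqP; rewrite eqEcard sy -!orderE oy /=.
  by rewrite !orderE -eq_cy.
rewrite -card_irr_index ?quotient_abelian //.
rewrite -(card_imset _ (can_inj (mod_IirrK nKH))).
apply: eq_card => i; rewrite !inE -val_eqE /=.
apply/andP/imsetP => [[/eqP oi /eqP def_K] | [j]].
  have sKi : K \subset irrk i by rewrite def_K.
  exists (quo_Iirr K i); last by rewrite quo_IirrK.
  rewrite inE quo_IirrE // cfker_quo //.
  rewrite index_quotient_eq ?cfker_sub ?normal_norm //.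
    by rewrite oi.
  exact: subset_trans (subsetIr _ _) sKi.
rewrite inE => /eqP oj ->; rewrite mod_IirrE //.
have sKj := cfker_mod ('chi_j)%R nKH.
have oi : #|H : cfker (('chi_j)%R %% K)%CF| = d.
  rewrite -oj -(quotient_cfker_mod K ('chi_j)%R nKH).
  rewrite index_quotient_eq ?cfker_sub ?normal_norm //.
  exact: subset_trans (subsetIr _ _) sKj.
rewrite oi eqxx; split=> //; rewrite eq_sym eqEcard sKj /=.
rewrite -(leq_pmul2r d_gt0) -{1}oi -iK Lagrange ?cfker_sub // iK.
by rewrite -iK Lagrange.
Qed.

Lemma num_cocyclicE (gT : finGroupType) (H : {group gT}) d :
  abelian H -> num_cocyclic H d = num_cyclic H d.
Proof.
move=> abH; have [->|d_gt0] := posnP d.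
  rewrite /num_cocyclic /num_cyclic !eq_card0 // => K; rewrite !inE.
    by rewrite -leqn0 leqNgt cardG_gt0 !andbF.
  by rewrite -leqn0 leqNgt indexg_gt0 !andbF.
apply/eqP; rewrite -(eqn_pmul2r (m := totient d)) ?totient_gt0 //.
by rewrite -num_cyclic_totient -num_cocyclic_totient // card_irr_index.
Qed.

Lemma num_cocyclic_quo (gT : finGroupType) (H N : {group gT}) d :
    abelian H -> N \subset H ->
  #|[set K : {group gT} |
     [&& K \subset H, cyclic (H / K), #|H : K| == d & N \subset K]]|
    = num_cocyclic (H / N) d.
Proof.
move=> abH sNH; have nNH : N <| H by rewrite -sub_abelian_normal.
pose quo (K : {group gT}) := (K / N)%G.
rewrite -(@card_in_imset _ _ quo) => [|K1 K2]; last first.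
  rewrite !inE => /and4P[sK1 _ _ NK1] /and4P[sK2 _ _ NK2].
  move/(congr1 val)/quotient_inj => eqK; apply/val_inj/eqK.
    exact: normalS NK1 sK1 nNH.
  exact: normalS NK2 sK2 nNH.
apply: eq_card => L; rewrite !inE; apply/imsetP/and3P.
  case=> K; rewrite inE => /and4P[sKH cyc iK sNK] ->.
  have nKH : K <| H by rewrite -sub_abelian_normal.
  rewrite quotientS // (isog_cyclic (third_isog sNK nNH nKH)) //.
  by rewrite index_quotient_eq ?normal_norm // (subset_trans (subsetIr _ _)).
case=> sLH cyc iL; have [K defL sNK sKH] := inv_quotientS nNH sLH.
have nKH : K <| H by rewrite -sub_abelian_normal.
exists K; last exact: val_inj.
rewrite inE sKH sNK -(isog_cyclic (third_isog sNK nNH nKH)) -defL cyc /= andbT.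
have <- : #|H / N : K / N| = #|H : K|; last by rewrite -defL.
by rewrite index_quotient_eq ?normal_norm // (subset_trans (subsetIr _ _)).
Qed.

End Duality.

(** * The universal property of a group algebra *)

Section GroupAlgebraMaps.
Import GRing.Theory.
Local Open Scope ring_scope.

Section UniversalProperty.
Variables (R : comNzRingType) (gT : finGroupType).
Local Notation RG := (group_alg R gT).

Definition galg_elt (x : gT) : RG := [ffun y => (y == x)%:R].

Definition galg_lift (A : lmodType R) (rho : gT -> A) (u : RG) : A :=
  \sum_x (u x : R) *: rho x.

Lemma galg_lift_is_linear (A : lmodType R) (rho : gT -> A) :
  linear (galg_lift rho).
Proof.
move=> k u v; rewrite /galg_lift scaler_sumr -big_split /=.
by apply: eq_bigr => x _; rewrite !ffunE scalerDl scalerA.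
Qed.
HB.instance Definition _ (A : lmodType R) (rho : gT -> A) :=
  GRing.isLinear.Build R RG A _ (galg_lift rho) (galg_lift_is_linear rho).

Lemma galg_lift_elt (A : lmodType R) (rho : gT -> A) x :
  galg_lift rho (galg_elt x) = rho x.
Proof.
rewrite /galg_lift (bigD1 x) //= ffunE eqxx scale1r big1 ?addr0 // => y.
by rewrite ffunE => /negPf->; rewrite scale0r.
Qed.

Lemma galg_sum_elt (u : RG) : u = \sum_x (u x : R) *: galg_elt x.
Proof.
apply/ffunP => y; rewrite sum_ffunE (bigD1 y) //= !ffunE eqxx.
rewrite big1 ?addr0 => [|x /negPf ne]; first by rewrite [RHS]mulr1.
by rewrite !ffunE eq_sym ne [LHS]mulr0.
Qed.

Lemma galg_elt1 : galg_elt 1%g = 1.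
Proof. by []. Qed.

Lemma galg_eltM x y : galg_elt (x * y)%g = galg_elt x * galg_elt y.
Proof.
apply/ffunP => z; rewrite !ffunE (bigD1 x) //= !ffunE eqxx mul1r.
rewrite big1 ?addr0 => [|t /negPf ne]; last by rewrite ffunE ne mul0r.
by rewrite (can2_eq (mulKVg x) (mulKg x)).
Qed.

Lemma galg_elt_mulE x (u : RG) y : (galg_elt x * u) y = u (x^-1 * y)%g.
Proof.
rewrite ffunE (bigD1 x) //= ffunE eqxx mul1r big1 ?addr0 // => z /negPf ne.
by rewrite ffunE ne mul0r.
Qed.

Lemma galg_mul_eltE x (u : RG) y : (u * galg_elt x) y = u (y * x^-1)%g.
Proof.
rewrite ffunE (bigD1 (y * x^-1)%g) //= ffunE invMg invgK mulgKV eqxx mulr1.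
rewrite big1 ?addr0 // => z ne; rewrite ffunE.
have [def_x | _] := eqVneq (z^-1 * y)%g x; last by rewrite mulr0.
by rewrite -def_x invMg invgK mulKVg eqxx in ne.
Qed.

Definition multiplicative_rep (A : pzRingType) (rho : gT -> A) :=
  rho 1%g = 1 /\ {morph rho : x y / (x * y)%g >-> x * y}.

Lemma galg_lift_monoid (A : algType R) (rho : gT -> A) :
  multiplicative_rep rho -> monoid_morphism (galg_lift rho).
Proof.
case=> rho1 rhoM; split; first by rewrite -galg_elt1 galg_lift_elt.
move=> u v; rewrite {1}[u]galg_sum_elt mulr_suml linear_sum.
rewrite [in RHS]/galg_lift mulr_suml; apply: eq_bigr => x _.
rewrite -scalerAl linearZ /= -scalerAl; congr (_ *: _).
rewrite {1}[v]galg_sum_elt mulr_sumr linear_sum mulr_sumr.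
apply: eq_bigr => y _.
by rewrite -scalerAr linearZ /= -galg_eltM galg_lift_elt rhoM scalerAr.
Qed.

End UniversalProperty.

Lemma galg_lift_comp (R : comNzRingType) (hT gT : finGroupType) (A : lmodType R)
    (rho : gT -> A) (f : hT -> gT) (u : group_alg R hT) :
  galg_lift rho (galg_lift (fun x => galg_elt R (f x)) u)
    = galg_lift (fun x => rho (f x)) u.
Proof.
rewrite {2}/galg_lift linear_sum; apply: eq_bigr => x _.
by rewrite linearZ /= galg_lift_elt.
Qed.

End GroupAlgebraMaps.

(** * Cyclotomic fields and cyclic quotients *)

Section Cyclotomic.
Import GRing.Theory.
Local Open Scope ring_scope.

Lemma zeta_primitive n : (0 < n)%N -> n.-primitive_root (zeta n).
Proof.
by case: n => // n _; apply: svalP (C_prim_root_exists (ltn0Sn n)).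
Qed.

Definition Qzeta_inj n : {rmorphism Qzeta n -> algC} :=
  tag (tagged (num_field_exists [:: zeta n])).

(** The list of preimages in [Qzeta n] of the generators [:: zeta n]. *)
Definition Qzeta_gens n : seq (Qzeta n) :=
  s2val (tagged (tagged (num_field_exists [:: zeta n]))).

Definition Qzeta_root n : Qzeta n := head 0 (Qzeta_gens n).

Lemma Qzeta_gensE n : Qzeta_gens n = [:: Qzeta_root n].
Proof.
have : map (Qzeta_inj n) (Qzeta_gens n) = [:: zeta n].
  exact: s2valP (tagged (tagged (num_field_exists [:: zeta n]))).
by rewrite /Qzeta_root; case: (Qzeta_gens n) => [|z [|? ?]].
Qed.

Lemma Qzeta_injE n : Qzeta_inj n (Qzeta_root n) = zeta n.
Proof.
have := s2valP (tagged (tagged (num_field_exists [:: zeta n]))).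
by rewrite -/(Qzeta_gens n) Qzeta_gensE => -[].
Qed.

Lemma Qzeta_span n (y : Qzeta n) :
  exists q : {poly rat}, y = (map_poly (in_alg (Qzeta n)) q).[Qzeta_root n].
Proof.
have /Fadjoin_polyP[q /polyOver1P[q' ->] def_y] : y \in <<1; Qzeta_root n>>%VS.
  have := s2valP' (tagged (tagged (num_field_exists [:: zeta n]))).
  by rewrite -/(Qzeta_gens n) Qzeta_gensE adjoin_seq1 => ->; apply: memvf.
by exists q'.
Qed.

Lemma Qzeta_root_primitive n : (0 < n)%N -> n.-primitive_root (Qzeta_root n).
Proof.
move=> n_gt0; rewrite -(fmorph_primitive_root (Qzeta_inj n)) Qzeta_injE.
exact: zeta_primitive.
Qed.

(** All primitive n-th roots of unity have the same minimal polynomial over the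
    rationals, the n-th cyclotomic polynomial. *)
Lemma root_primitive_indep n (z1 z2 : algC) (q : {poly rat}) :
    n.-primitive_root z1 -> n.-primitive_root z2 ->
  root (map_poly ratr q) z1 -> root (map_poly ratr q) z2.
Proof.
move=> z1n z2n.
have [q1 [e1 _] d1] := minCpolyP z1; have [q2 [e2 _] d2] := minCpolyP z2.
have -> // : root (map_poly ratr q) z1 = root (map_poly ratr q) z2.
rewrite d1 d2; congr (_ %| _)%R.
apply: (map_poly_inj (ratr : {rmorphism rat -> algC})); rewrite /= -e1 -e2.
rewrite (minCpoly_cyclotomic z1n) (minCpoly_cyclotomic z2n).
by rewrite -!Cintr_Cyclotomic.
Qed.

End Cyclotomic.

Section DiscreteLog.
Import GroupScope.

Definition dlog (gT : finGroupType) (c y : gT) :=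
  find (fun m => c ^+ m == y) (iota 0 #[c]).

Lemma expg_dlog (gT : finGroupType) (c y : gT) :
  y \in <[c]> -> c ^+ dlog c y = y.
Proof.
case/cyclePmin => i lt_i def_y.
have has_y : has (fun m => c ^+ m == y) (iota 0 #[c]).
  by apply/hasP; exists i; rewrite ?mem_iota ?def_y.
have := nth_find 0 has_y; rewrite nth_iota ?add0n => [/eqP //|].
by rewrite has_find size_iota in has_y.
Qed.

Definition cyc_gen (gT : finGroupType) (A : {set gT}) :=
  odflt 1 [pick c | A == <[c]>].

Lemma cyc_genP (gT : finGroupType) (A : {set gT}) :
  cyclic A -> A = <[cyc_gen A]>.
Proof.
case/cyclicP => c def_c; rewrite /cyc_gen; case: pickP => [x /eqP //|/(_ c)].
by rewrite def_c eqxx.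
Qed.

Definition quo_log (gT : finGroupType) (H K : {set gT}) h :=
  dlog (cyc_gen (H / K)) (coset K h).

(** A primitive root z of order #|H : K| turns the discrete logarithm in H / K
    into a homomorphism h |-> z ^+ quo_log H K h of kernel K. *)
Variables (gT : finGroupType) (H K : {group gT}).
Hypotheses (nKH : K <| H) (cycHK : cyclic (H / K)).

Lemma coset_quo_log h :
  h \in H -> coset K h = cyc_gen (H / K) ^+ quo_log H K h.
Proof. by move=> Hh; rewrite expg_dlog // -cyc_genP ?mem_quotient. Qed.

Section Root.
Local Open Scope ring_scope.
Import GRing.Theory.
Variables (F : fieldType) (z : F).
Hypothesis z_prim : #|H : K|.-primitive_root z.

Lemma eq_expr_quo_log i j :
  (z ^+ i == z ^+ j) = (cyc_gen (H / K) ^+ i == cyc_gen (H / K) ^+ j)%g.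
Proof.
rewrite (eq_prim_root_expr z_prim) eq_expg_mod_order.
by rewrite orderE -cyc_genP // card_quotient ?normal_norm.
Qed.

Lemma root_quo_log1 : z ^+ quo_log H K 1%g = 1.
Proof.
apply/eqP; rewrite -[X in _ == X](expr0 z) eq_expr_quo_log -coset_quo_log //.
by rewrite morph1.
Qed.

Lemma root_quo_logM x y : x \in H -> y \in H ->
  z ^+ quo_log H K (x * y)%g = z ^+ quo_log H K x * z ^+ quo_log H K y.
Proof.
move=> Hx Hy; apply/eqP; rewrite -exprD eq_expr_quo_log expgD.
rewrite -!coset_quo_log ?groupM //.
by rewrite morphM ?(subsetP (normal_norm nKH)).
Qed.

Lemma root_quo_log_eq1 x : x \in H -> (z ^+ quo_log H K x == 1) = (x \in K).
Proof.
move=> Hx; rewrite -[X in _ == X](expr0 z) eq_expr_quo_log.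
rewrite -coset_quo_log // expg0.
apply/eqP/idP => [/coset_idr|]; last exact: coset_id.
by apply; apply: (subsetP (normal_norm nKH)).
Qed.

Lemma root_quo_log_surj : exists2 x, x \in H & z ^+ quo_log H K x = z.
Proof.
have : cyc_gen (H / K)%g \in (H / K)%g by rewrite {2}(cyc_genP cycHK) cycle_id.
case/morphimP => x nKx Hx def_c; exists x => //.
apply/eqP; rewrite -[X in _ == X](expr1 z) eq_expr_quo_log.
by rewrite -coset_quo_log // def_c.
Qed.

End Root.
End DiscreteLog.

(** * Separating the characters of a finite group by their kernels *)

Section Isolators.
Import GRing.Theory.
Local Open Scope ring_scope.
Variable hT : finGroupType.
Implicit Types K L N : {group hT}.

Definition rep_ker (A : pzRingType) (rho : hT -> A) K :=
  forall x, (rho x == 1) = (x \in K).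

(** If some k in L is not in K then r = 1 - k will do.  Otherwise L is a proper
    subgroup of K, and r is the sum of the elements of K: a character of kernel
    K maps it to #|K|, while one of kernel L is nontrivial on K and thus sums to
    zero over K. *)
Lemma kernel_separator K L : K != L ->
  exists r : group_alg rat hT, forall (F : fieldExtType rat) (rho : hT -> F),
    multiplicative_rep rho ->
    (rep_ker rho K -> galg_lift rho r != 0) /\
    (rep_ker rho L -> galg_lift rho r = 0).
Proof.
have [sLK neKL | /subsetPn[k Lk K'k] _] := boolP (L \subset K); last first.
  exists (1 - galg_elt rat k) => F rho rhoP.
  have -> : galg_lift rho (1 - galg_elt rat k) = 1 - rho k.
    by rewrite linearB [X in X - _](galg_lift_monoid rhoP).1 /= galg_lift_elt.
  split=> kerP; last by apply/eqP; rewrite subr_eq0 eq_sym kerP.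
  by rewrite subr_eq0 eq_sym kerP.
exists (\sum_(k in K) galg_elt rat k) => F rho [rho1 rhoM].
have -> : galg_lift rho (\sum_(k in K) galg_elt rat k) = \sum_(k in K) rho k.
  by rewrite linear_sum; apply: eq_bigr => k _; rewrite /= galg_lift_elt.
split=> kerP.
  rewrite (eq_bigr (fun=> 1)) => [|k Kk]; last by apply/eqP; rewrite kerP.
  rewrite sumr_const -(rmorph_nat (in_alg F)) fmorph_eq0.
  by rewrite Num.Theory.pnatr_eq0 -lt0n cardG_gt0.
have /subsetPn[k Kk L'k] : ~~ (K \subset L).
  by apply: contra neKL => sKL; rewrite -val_eqE eqEsubset sKL.
have : (1 - rho k) * \sum_(k in K) rho k = 0.
  apply/eqP; rewrite mulrBl mul1r subr_eq0; apply/eqP.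
  rewrite [LHS](reindex_inj (mulgI k)) mulr_sumr /=.
  by apply: eq_big => [x|x _]; rewrite ?rhoM // groupMl.
by move/eqP; rewrite mulf_eq0 subr_eq0 eq_sym kerP (negPf L'k) => /eqP.
Qed.

(** The product of the separators of K from all the other subgroups, times
    1 - n for some n in N that is not in K. *)
Lemma kernel_isolator K N : ~~ (N \subset K) ->
  exists e : group_alg rat hT,
   [/\ forall (F : fieldExtType rat) (rho : hT -> F),
         multiplicative_rep rho -> rep_ker rho K -> galg_lift rho e != 0,
       forall (F : fieldExtType rat) (rho : hT -> F) L,
         multiplicative_rep rho -> rep_ker rho L -> L != K ->
         galg_lift rho e = 0
     & forall (A : algType rat) (rho : hT -> A),
         multiplicative_rep rho -> {in N, forall x, rho x = 1} ->
         galg_lift rho e = 0].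
Proof.
case/subsetPn => n Nn K'n.
have /fin_all_exists[r rP] (L : {group hT}) : exists r : group_alg rat hT,
    L != K -> forall (F : fieldExtType rat) (rho : hT -> F),
    multiplicative_rep rho ->
    (rep_ker rho K -> galg_lift rho r != 0) /\
    (rep_ker rho L -> galg_lift rho r = 0).
  have [->|neLK] := eqVneq L K; first by exists 0.
  by have [|r rP] := @kernel_separator K L; [rewrite eq_sym | exists r].
pose s := [seq L <- index_enum {group hT} | L != K].
exists ((1 - galg_elt rat n) * \prod_(L <- s) r L).
have liftP (A : algType rat) (rho : hT -> A) (t : seq {group hT}) :
    multiplicative_rep rho ->
    galg_lift rho ((1 - galg_elt rat n) * \prod_(L <- t) r L)
     = (1 - rho n) * \prod_(L <- t) galg_lift rho (r L).
  move=> /[dup] /galg_lift_monoid[l1 lM] [rho1 rhoM].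
  rewrite lM linearB /= l1 galg_lift_elt; congr (_ * _).
  by apply: (big_morph _ lM l1).
split=> [F rho rhoP kerP | F rho L rhoP kerP neLK | A rho rhoP rhoN];
  rewrite liftP //.
- apply: mulf_neq0; first by rewrite subr_eq0 eq_sym kerP.
  rewrite prodf_seq_neq0; apply/allP => L.
  rewrite mem_filter => /andP[neLK _] /=.
  by apply: (rP L neLK F rho rhoP).1.
- apply/eqP; rewrite mulf_eq0 prodf_seq_eq0; apply/orP; right.
  apply/hasP; exists L; first by rewrite mem_filter neLK mem_index_enum.
  by apply/eqP; apply: (rP L neLK F rho rhoP).2.
by rewrite rhoN // subrr mul0r.
Qed.

End Isolators.

(** * The irreducible rational representations of an abelian group *)

Section KernelCharacter.
Import GRing.Theory.
Local Open Scope ring_scope.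
Variables (gT : finGroupType) (H : {group gT}).

Definition ker_char (d : nat) (K : {set gT}) (h : gT) : Qzeta d :=
  Qzeta_root d ^+ quo_log H K h.

Definition ker_char_lift d (K : {set gT}) :
    group_alg rat (subg_of H) -> Qzeta d :=
  galg_lift (fun x : subg_of H => ker_char d K (sgval x)).

Section OneKernel.
Variables (d : nat) (K : {group gT}).
Hypotheses (nKH : (K <| H)%g) (cycHK : cyclic (H / K)%g) (iK : #|H : K|%g = d).

Lemma ker_root_prim : #|H : K|%g.-primitive_root (Qzeta_root d).
Proof. by rewrite iK; apply: Qzeta_root_primitive; rewrite -iK. Qed.

Lemma ker_charM : {in H &, {morph ker_char d K : x y / (x * y)%g >-> x * y}}.
Proof. by move=> x y Hx Hy; apply: (root_quo_logM nKH cycHK ker_root_prim). Qed.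

Lemma ker_char1 : ker_char d K 1%g = 1.
Proof. exact: (root_quo_log1 nKH cycHK ker_root_prim). Qed.

Lemma ker_char_eq1 x : x \in H -> (ker_char d K x == 1) = (x \in K).
Proof. exact: (root_quo_log_eq1 nKH cycHK ker_root_prim). Qed.

Lemma ker_char_rep :
  multiplicative_rep (fun x : subg_of H => ker_char d K (sgval x)).
Proof.
by split=> [|x y]; rewrite ?ker_char1 //= ker_charM ?subgP.
Qed.

Lemma ker_char_lift_surj y : exists u, @ker_char_lift d K u = y.
Proof.
have [x Hx zx] := root_quo_log_surj nKH cycHK ker_root_prim.
have [q ->] := Qzeta_span y.
have [l1 lM] := galg_lift_monoid ker_char_rep.
exists (\sum_(i < size q) q`_i *: (galg_elt rat (subg H x)) ^+ i).
rewrite /ker_char_lift linear_sum horner_coef size_map_poly.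
apply: eq_bigr => i _.
rewrite linearZ /= coef_map /= -[RHS]/(q`_i *: 1 * _) -scalerAl mul1r.
congr (_ *: _).
elim: (nat_of_ord i) => [|n IHn]; first by rewrite !expr0.
by rewrite !exprS lM IHn galg_lift_elt subgK // /ker_char zx.
Qed.

(** For x in H whose coset generates H / K, both characters are powers of their
    value at x with the same exponents, and these values are primitive d-th
    roots of unity.  The hypothesis and the conclusion thus say that one
    rational polynomial q vanishes at two primitive d-th roots of unity. *)
Lemma ker_char_lift_irr (i : Iirr H) (w : group_alg rat (subg_of H)) :
    abelian H -> cfker ('chi_i) = K -> ker_char_lift d K w = 0 ->
  \sum_x ratr (w x) * 'chi_i (sgval x) = 0.
Proof.
move=> abH keri wK.
have lin_i : 'chi_i \is a linear_char by apply/char_abelianP.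
have [x Hx zx] := root_quo_log_surj nKH cycHK ker_root_prim.
have chi_eq1 h : h \in H -> ('chi_i h == 1) = (h \in K).
  by move=> Hh; rewrite -keri cfkerEirr inE lin_char1.
have nKx := subsetP (normal_norm nKH) x Hx.
have def_c : coset K x = cyc_gen (H / K)%g.
  rewrite (coset_quo_log cycHK Hx) -[RHS]expg1; apply/eqP.
  by rewrite -(eq_expr_quo_log nKH cycHK ker_root_prim) expr1; apply/eqP.
have log_chi h : h \in H -> 'chi_i h = 'chi_i x ^+ quo_log H K h.
  move=> Hh; rewrite -lin_charX //.
  have [|||k Kk def_h] := @kercoset_rcoset _ K h (x ^+ quo_log H K h)%g.
  - exact: subsetP (normal_norm nKH) h Hh.
  - by rewrite groupX.
  - by rewrite morphX //= (coset_quo_log cycHK Hh) def_c.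
  have Hk := subsetP (normal_sub nKH) k Kk.
  have /eqP chi_k : 'chi_i k == 1 by rewrite chi_eq1.
  by rewrite {1}def_h lin_charM ?groupX // chi_k mul1r.
have d_gt0 : (0 < d)%N by rewrite -iK.
have prim_x : d.-primitive_root ('chi_i x).
  have chi_dvd n : ('chi_i x ^+ n == 1) = (d %| n)%N.
    rewrite -lin_charX // (chi_eq1 _ (groupX n Hx)) -iK.
    rewrite -card_quotient ?normal_norm //.
    rewrite (cyc_genP cycHK) -def_c -orderE order_dvdn -morphX //=.
    by apply/idP/eqP => [/coset_id//|/coset_idr->] //; rewrite groupX.
  have chi_d : 'chi_i x ^+ d = 1 by apply/eqP; rewrite chi_dvd.
  have [m prim_m] := prim_order_exists d_gt0 chi_d.
  move=> m_dv; have := chi_dvd m; rewrite (prim_expr_order prim_m) eqxx => /esym dv_m.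
  by have /eqP<- : m == d by rewrite eqn_dvd m_dv dv_m.
pose q : {poly rat} := \sum_x (w x : rat) *: 'X^(quo_log H K (sgval x)).
have q_root (z : algC) : (map_poly ratr q).[z]
    = \sum_x ratr (w x) * z ^+ quo_log H K (sgval x).
  rewrite rmorph_sum horner_sum; apply: eq_bigr => y _ /=.
  by rewrite linearZ /= map_polyXn hornerZ hornerXn.
have /eqP : root (map_poly ratr q) ('chi_i x).
  apply: (root_primitive_indep (zeta_primitive d_gt0) prim_x).
  rewrite /root q_root (_ : \sum_x _ = Qzeta_inj d (ker_char_lift d K w)).
    by rewrite wK rmorph0.
  rewrite rmorph_sum; apply: eq_bigr => y _ /=.
  rewrite -[_ *: _]mulr_algl rmorphM rmorphXn /= Qzeta_injE; congr (_ * _).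
  by rewrite alg_num_field fmorph_rat.
rewrite q_root => q0; rewrite -[RHS]q0; apply: eq_bigr => y _.
by rewrite log_chi ?subgP.
Qed.

End OneKernel.
End KernelCharacter.

(** * Conjugacy classes of kernels *)

Section MovedKernels.
Import GroupScope.

Definition moved_kernels (gT : finGroupType) (G H : {group gT}) d :=
  [set K : {group gT} |
    [&& K \subset H, cyclic (H / K), #|H : K| == d & ~~ (G^`(1) \subset K)]].

Definition kernel_reps (gT : finGroupType) (G H : {group gT}) d :=
  orbit_transversal 'JG G (moved_kernels G H d).

Variables (p : nat) (gT : finGroupType) (G H : {group gT}).
Hypotheses (p_prime : prime p) (p_odd : odd p) (pG : p.-group G).
Hypotheses (oG : #|G| = (p ^ 4)%N) (clG : nil_class G = 3).
Hypotheses (sHG : H \subset G) (abH : abelian H) (iH : #|G : H| = p).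

Let nHG : H <| G := max_normal p_prime pG sHG iH.

Lemma card_moved_kernels d :
  #|moved_kernels G H d| + num_cyclic (H / G^`(1)) d = num_cyclic H d.
Proof.
have sDH := der1_sub_max p_prime pG sHG iH.
rewrite -!num_cocyclicE ?quotient_abelian // -(num_cocyclic_quo _ abH sDH).
rewrite /num_cocyclic -[RHS](cardsID [set K : {group gT} | G^`(1) \subset K]) addnC.
by congr (_ + _); apply: eq_card => K; rewrite !inE;
  case: (K \subset H); case: (cyclic _); case: (_ == d); case: (_ \subset K).
Qed.

Lemma cyclic_quo_conj (K : {group gT}) x :
  x \in G -> K \subset H -> cyclic (H / K) -> cyclic (H / (K :^ x)).
Proof.
move=> Gx sKH cyc; have nHx := subsetP (normal_norm nHG) x Gx.
have nKH : K <| H by rewrite -sub_abelian_normal.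
have : cyclic (conjgm H x @* H / conjgm H x @* K).
  by rewrite -(morphim_quotm _ nKH) morphim_cyclic.
by rewrite (norm_conjg_im nHx) morphim_conj (setIidPr sKH).
Qed.

Lemma moved_kernelsJ d K x :
  x \in G -> (K :^ x)%G \in moved_kernels G H d = (K \in moved_kernels G H d).
Proof.
have imp L y : y \in G ->
    L \in moved_kernels G H d -> (L :^ y)%G \in moved_kernels G H d.
  move=> Gy; have nHy := subsetP (normal_norm nHG) y Gy.
  have nDy := subsetP (der_norm 1 G) y Gy.
  rewrite !inE => /and4P[sLH cyc iL sDL].
  rewrite /= -{1}(normP nHy) conjSg sLH cyclic_quo_conj //=.
  by rewrite -{1}(normP nHy) indexJg iL -(normP nDy) conjSg.
move=> Gx; apply/idP/idP; last exact: imp.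
have GVx : x^-1 \in G by rewrite groupV.
move/(imp _ _ GVx).
suff -> : ((K :^ x) :^ x^-1)%G = K by [].
by apply: val_inj; rewrite /= conjsgK.
Qed.

Lemma acts_moved_kernels d : [acts G, on moved_kernels G H d | 'JG].
Proof.
by apply/actsP => x Gx K; apply: moved_kernelsJ.
Qed.

(** H normalizes K, as H is abelian; since H is maximal in G, the normalizer of
    K is either H or G, and [der1_sub_normal] excludes G. *)
Lemma norm_moved_kernel d K : K \in moved_kernels G H d -> 'N_G(K) = H.
Proof.
rewrite inE => /and4P[sKH cyc _ notD].
have maxH : maximal H G by apply: p_index_maximal => //; rewrite iH.
have sHN : H \subset 'N_G(K) by rewrite subsetI sHG sub_abelian_norm.
case/maxgroupP: maxH => _ maxH.
have [eqNG | neNG] := eqVneq 'N_G(K) G.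
  case/negP: notD.
  apply: (der1_sub_normal p_prime p_odd pG oG clG sHG abH iH) => //.
  by rewrite /normal (subset_trans sKH sHG) -{1}eqNG subsetIr.
by apply: maxH => //; rewrite properEneq neNG subsetIl.
Qed.

Lemma card_kernel_reps d : #|moved_kernels G H d| = (#|kernel_reps G H d| * p)%N.
Proof.
have actM := acts_moved_kernels d.
have [trX _ _ _] := orbit_transversalP actM.
rewrite (card_transversal trX).
apply: card_uniform_partition (orbit_partition actM) => _ /imsetP[K MK ->].
by rewrite card_orbit astab1JG (norm_moved_kernel MK).
Qed.

Lemma kernel_reps_mem d K : K \in kernel_reps G H d -> K \in moved_kernels G H d.
Proof.
have [_ /subsetP sXM _ _] := orbit_transversalP (acts_moved_kernels d).
exact: sXM.
Qed.

Lemma kernel_reps_inj d K L x : K \in kernel_reps G H d ->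
  L \in kernel_reps G H d -> x \in G -> L = (K :^ x)%G -> K = L.
Proof.
move=> XK XL Gx defL; have [_ _ inj _] := orbit_transversalP (acts_moved_kernels d).
by apply/eqP; rewrite -inj // defL; apply/imsetP; exists x.
Qed.

Lemma kernel_reps_ex d K : K \in moved_kernels G H d ->
  exists2 x, x \in G & (K :^ x)%G \in kernel_reps G H d.
Proof.
by have [_ _ _ ex] := orbit_transversalP (acts_moved_kernels d); apply: ex.
Qed.

End MovedKernels.

(** * Induced representations *)

Section MatrixEntries.
Import GRing.Theory.
Local Open Scope ring_scope.

Lemma mxalgZE (R : pzRingType) (A : algType R) n k (x : mxalg A n) i j :
  (k *: x : mxalg A n) i j = k *: (x i j).
Proof. by rewrite mxE. Qed.

Lemma mxalg_sumE (R : pzRingType) (A : algType R) n (I : finType) (P : pred I)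
    (F : I -> mxalg A n) i j :
  (\sum_(k | P k) F k : mxalg A n) i j = \sum_(k | P k) F k i j.
Proof. exact: summxE. Qed.

Lemma mxalgME (R : pzRingType) (A : algType R) n (x y : mxalg A n) i j :
  (x * y : mxalg A n) i j = \sum_k x i k * y k j.
Proof. by rewrite mxE. Qed.

Lemma sum_subg (V : nmodType) (gT : finGroupType) (G : {group gT}) (F : gT -> V) :
  \sum_(x : subg_of G) F (sgval x) = \sum_(x in G) F x.
Proof.
rewrite [RHS](reindex_onto sgval (subg G)) /=; last by move=> x /subgK.
by apply: eq_bigl => x; rewrite sgvalK eqxx subgP.
Qed.

End MatrixEntries.

Section InducedRepresentation.
Import GRing.Theory.
Local Open Scope ring_scope.
Variables (gT : finGroupType) (G H : {group gT}) (p : nat).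
Variable r : 'I_p.-1.+1 -> gT.
Hypotheses (sHG : H \subset G) (abH : abelian H) (nHG : (H <| G)%g).
Hypothesis rG : forall a, r a \in G.
Hypothesis r0 : r ord0 = 1%g.
Hypothesis rP : forall x, x \in G ->
  exists b, forall c, (x * (r c)^-1 \in H)%g = (c == b).

(** The representation of G induced from [ker_char H d K], in the basis given by
    the coset representatives [r a]. *)
Definition ind_mx d (K : {group gT}) (g : gT) : mxalg (Qzeta d) p :=
  \matrix_(a, b) (if (r a * g * (r b)^-1 \in H)%g
                  then ker_char H d K (r a * g * (r b)^-1)%g else 0).

Definition ind_lift d (K : {group gT}) :
    group_alg rat (subg_of G) -> mxalg (Qzeta d) p :=
  galg_lift (fun x : subg_of G => ind_mx d K (sgval x)).

Lemma transversal_eq a b : (r a * (r b)^-1 \in H)%g = (b == a).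
Proof.
have [c rc] := rP (rG a).
by have := rc a; rewrite mulgV group1 rc => /esym/eqP->.
Qed.

Section OneKernel.
Variables (d : nat) (K : {group gT}).
Hypotheses (nKH : (K <| H)%g) (cycHK : cyclic (H / K)%g) (iK : #|H : K|%g = d).

Let lam1 := ker_char1 nKH cycHK iK.
Let lamM := ker_charM nKH cycHK iK.

(** In row a of the matrix of x, the only nonzero entry is in the column b such
    that r a * x is in the coset of r b; so each entry of a product of two such
    matrices reduces to one term. *)
Lemma ind_mx_rep : multiplicative_rep (fun x : subg_of G => ind_mx d K (sgval x)).
Proof.
split=> [|x y].
  apply/matrixP => a b; rewrite !mxE mulg1 transversal_eq eq_sym.
  by case: eqVneq => // ->; rewrite mulgV lam1.
apply/matrixP => a c; rewrite mxalgME !mxE /=.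
have [b xb] := rP (groupM (rG a) (subgP x)).
rewrite (bigD1 b) //= !mxE xb eqxx.
rewrite [X in _ + X]big1 ?addr0 => [|b' /negPf neb]; last first.
  by rewrite !mxE xb neb mul0r.
have Hab : (r a * sgval x * (r b)^-1)%g \in H by rewrite xb.
have -> : (r a * (sgval x * sgval y) * (r c)^-1
   = (r a * sgval x * (r b)^-1) * (r b * sgval y * (r c)^-1))%g.
  by rewrite !mulgA mulgKV.
rewrite (groupMl _ Hab).
have [Hbc | _] := boolP (r b * sgval y * (r c)^-1 \in H)%g; last by rewrite mulr0.
by rewrite lamM.
Qed.

End OneKernel.

Definition galg_incl : group_alg rat (subg_of H) -> group_alg rat (subg_of G) :=
  galg_lift (fun x : subg_of H => galg_elt rat (subg G (sgval x))).

(** H is normal, so the elements of QH act diagonally, by the conjugates of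
    [ker_char H d K]. *)
Lemma ind_lift_incl d K w a b : ind_lift d K (galg_incl w) a b =
  if a == b then
    galg_lift (fun x : subg_of H => ker_char H d K (r a * sgval x * (r a)^-1)%g) w
  else 0.
Proof.
rewrite /ind_lift /galg_incl {2}/galg_lift linear_sum mxalg_sumE.
have nH a' (h : subg_of H) : (r a' * sgval h * (r a')^-1)%g \in H.
  rewrite -mulgA -{1}[r a']invgK -conjgE memJ_norm ?subgP //.
  by rewrite groupV (subsetP (normal_norm nHG)).
case: eqP => [<- | /eqP neab]; last first.
  apply: big1 => h _; rewrite linearZ /= galg_lift_elt mxalgZE mxE.
  rewrite subgK ?(subsetP sHG) ?subgP //.
  have -> : (r a * sgval h * (r b)^-1
      = (r a * sgval h * (r a)^-1) * (r a * (r b)^-1))%g.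
    by rewrite !mulgA mulgKV.
  by rewrite groupMl ?nH // transversal_eq eq_sym (negPf neab) scaler0.
apply: eq_bigr => h _; rewrite linearZ /= galg_lift_elt mxalgZE mxE.
by rewrite subgK ?(subsetP sHG) ?subgP // nH.
Qed.

Definition galg_quo (N : {group gT}) :
    group_alg rat (subg_of G) -> group_alg rat (subg_of (G / N)%G) :=
  galg_lift (fun x : subg_of G =>
    galg_elt rat (subg (G / N)%G (coset N (sgval x)))).

Section Quotient.
Variables (N : {group gT}).
Hypothesis nNG : (N <| G)%g.

Lemma galg_quo_rep : multiplicative_rep (fun x : subg_of G =>
    galg_elt rat (subg (G / N)%G (coset N (sgval x)))).
Proof.
have nN x : x \in G -> x \in 'N(N)%g by apply: (subsetP (normal_norm nNG)).
split=> [|x y]; first by rewrite /= morph1 morph1.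
rewrite -galg_eltM /= morphM ?nN ?subgP //= subgM //; exact: mem_quotient (subgP _).
Qed.

End Quotient.


Definition subg_pre (L : {group gT}) : {group subg_of H} := (sgval @*^-1 L)%G.

Lemma mem_subg_pre L x : (x \in subg_pre L) = (sgval x \in L).
Proof. by rewrite !inE. Qed.

Lemma subg_pre_inj (K L : {group gT}) :
  K \subset H -> L \subset H -> subg_pre K = subg_pre L -> K = L.
Proof.
move=> /subsetP sKH /subsetP sLH eqKL; apply/val_inj/setP => x.
have [Hx | H'x] := boolP (x \in H).
  by have := mem_subg_pre K (subg H x); rewrite eqKL mem_subg_pre /= subgK.
by rewrite (contraNF (sKH x) H'x) (contraNF (sLH x) H'x).
Qed.

Section Conjugates.
Variables (d : nat) (K : {group gT}) (s : gT).
Hypotheses (sKH : K \subset H) (cycHK : cyclic (H / K)%g) (iK : #|H : K|%g = d).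
Hypothesis Gs : s \in G.

Let nKH : (K <| H)%g. Proof. by rewrite -sub_abelian_normal. Qed.

Let conjH (x : subg_of H) : (s * sgval x * s^-1)%g \in H.
Proof.
rewrite -mulgA -{1}[s]invgK -conjgE memJ_norm ?subgP //.
by rewrite groupV (subsetP (normal_norm nHG)).
Qed.

Lemma conj_char_rep :
  multiplicative_rep (fun x : subg_of H => ker_char H d K (s * sgval x * s^-1)%g).
Proof.
split=> [|x y]; first by rewrite mulg1 mulgV (ker_char1 nKH cycHK iK).
rewrite -(ker_charM nKH cycHK iK) ?conjH //; congr (ker_char _ _ _ _).
by rewrite /= !mulgA mulgKV.
Qed.

Lemma conj_char_ker :
  rep_ker (fun x : subg_of H => ker_char H d K (s * sgval x * s^-1)%g)
    (subg_pre (K :^ s)).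
Proof.
move=> x; rewrite (ker_char_eq1 nKH cycHK iK) ?conjH // mem_subg_pre mem_conjg.
by rewrite conjgE invgK mulgA.
Qed.

End Conjugates.

(** Such a w acts as a multiple of the matrix unit (0, 0), because r ord0 = 1;
    multiplication by (r a)^-1 on the left and r b on the right moves it to the
    place (a, b). *)
Lemma ind_lift_sandwich d (K : {group gT}) w a b :
    K \subset H -> cyclic (H / K)%g -> #|H : K|%g = d ->
    (forall i, i != ord0 ->
      galg_lift (fun x : subg_of H =>
        ker_char H d K (r i * sgval x * (r i)^-1)%g) w = 0) ->
  ind_lift d K (galg_elt rat (subg G (r a)^-1%g) * galg_incl w
      * galg_elt rat (subg G (r b)))
    = \matrix_(i, j) (if (i == a) && (j == b) then ker_char_lift d K w else 0).
Proof.
move=> sKH cycHK iK w0; have nKH : (K <| H)%g by rewrite -sub_abelian_normal.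
have [_ lM] := galg_lift_monoid (ind_mx_rep nKH cycHK iK).
have D i j : ind_lift d K (galg_incl w) i j =
    if (i == ord0) && (j == ord0) then ker_char_lift d K w else 0.
  rewrite ind_lift_incl; case: (eqVneq i j) => [<- | neij].
    rewrite andbb; case: (eqVneq i ord0) => [-> | nei]; last exact: w0.
    rewrite /ker_char_lift /galg_lift; apply: eq_bigr => x _; congr (_ *: _).
    by rewrite r0 mul1g invg1 mulg1.
  have [i0 /= | _ //] := eqVneq i ord0; have [j0 | _ //] := eqVneq j ord0.
  by rewrite i0 j0 eqxx in neij.
have ker1 := ker_char1 nKH cycHK iK.
apply/matrixP => i j; rewrite /ind_lift !lM -!/(ind_lift _ _ _) !mxalgME.
rewrite (bigD1 ord0) //= big1 ?addr0 => [|k /negPf nek]; last first.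
  by rewrite mxalgME big1 ?mul0r // => l _; rewrite D nek andbF mulr0.
rewrite mxalgME (bigD1 ord0) //= big1 ?addr0 => [|l /negPf nel]; last first.
  by rewrite D nel mulr0.
rewrite D eqxx /= /ind_lift !galg_lift_elt !mxE !subgK ?groupV //.
rewrite r0 mul1g invg1 mulg1.
rewrite !transversal_eq eq_sym; case: eqVneq => [->|_] /=; last by rewrite !mul0r.
rewrite mulgV ker1 mul1r; case: eqVneq => [->|_] /=; last by rewrite mulr0.
by rewrite mulgV ker1 mulr1.
Qed.

(** M is a combination of matrix units with coefficients in Q(zeta_d), and these
    coefficients are values on QH of the character of kernel K.  Multiplying by
    the isolator e of K makes a lift vanish under all the characters of H with
    another kernel, hence under the representations induced from kernels not
    conjugate to K, and under the map to Q(G/N). *)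
Lemma ind_lift_isolate (N : {group gT}) d (K : {group gT})
    (M : mxalg (Qzeta d) p) :
    (N <| G)%g -> N \subset H ->
    K \subset H -> cyclic (H / K)%g -> #|H : K|%g = d -> ~~ (N \subset K) ->
    (forall x, x \in G -> x \notin H -> (K :^ x)%G != K) ->
  exists u : group_alg rat (subg_of G),
  [/\ ind_lift d K u = M,
      forall d' (L : {group gT}),
        L \subset H -> cyclic (H / L)%g -> #|H : L|%g = d' ->
        (forall x, x \in G -> (L :^ x)%G != K) -> ind_lift d' L u = 0
    & galg_quo N u = 0].
Proof.
move=> nNG sNH sKH cycHK iK notN moveK.
have nKH : (K <| H)%g by rewrite -sub_abelian_normal.
have notN' : ~~ (subg_pre N \subset subg_pre K).
  case/subsetPn: notN => n Nn K'n; apply/subsetPn; have Hn := subsetP sNH n Nn.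
  by exists (subg H n); rewrite mem_subg_pre subgK.
have [e [eK eL eN]] := kernel_isolator notN'.
have [l1 lM] := galg_lift_monoid (ker_char_rep nKH cycHK iK).
have conjsub (L : {group gT}) x : L \subset H -> x \in G -> (L :^ x)%G \subset H.
  move=> sLH Gx; rewrite /= -(normP (subsetP (normal_norm nHG) x Gx)).
  by rewrite conjSg.
have ker0 d' (L : {group gT}) x :
    L \subset H -> cyclic (H / L)%g -> #|H : L|%g = d' -> x \in G ->
    (L :^ x)%G != K ->
    galg_lift (fun y : subg_of H => ker_char H d' L (x * sgval y * x^-1)%g) e = 0.
  move=> sLH cycHL iL Gx neLK; apply: (eL _ _ (subg_pre (L :^ x)%G)).
  - exact: conj_char_rep.
  - exact: conj_char_ker.
  by apply: contra neLK => /eqP/subg_pre_inj->; rewrite ?conjsub.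
have eK0 : ker_char_lift d K e != 0.
  apply: eK; first exact: ker_char_rep.
  by move=> x; rewrite (ker_char_eq1 nKH cycHK iK) ?subgP // mem_subg_pre.
have /fin_all_exists[w wP] (ab : 'I_p.-1.+1 * 'I_p.-1.+1) :
    exists w, @ker_char_lift gT H d K w = M ab.1 ab.2 / ker_char_lift d K e.
  exact: ker_char_lift_surj.
pose U ab := galg_elt rat (subg G (r ab.1)^-1%g) * galg_incl (w ab * e) *
  galg_elt rat (subg G (r ab.2)).
have liftM d' (L : {group gT}) x v :
    L \subset H -> cyclic (H / L)%g -> #|H : L|%g = d' ->
    x \in G -> (L :^ x)%G != K ->
    galg_lift (fun y : subg_of H =>
      ker_char H d' L (x * sgval y * x^-1)%g) (v * e) = 0.
  move=> sLH cycHL iL Gx neLK.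
  by rewrite (galg_lift_monoid (conj_char_rep sLH cycHL iL Gx)).2 ker0 ?mulr0.
have UE ab : ind_lift d K (U ab) = \matrix_(i, j)
    (if (i == ab.1) && (j == ab.2) then M ab.1 ab.2 else 0).
  rewrite /U ind_lift_sandwich // => [|i nei].
    apply/matrixP => i j; rewrite !mxE; case: ifP => // _.
    by rewrite /ker_char_lift lM [X in X * _]wP divfK.
  apply: liftM => //; apply: moveK => //.
  by rewrite -[r i]mulg1 -invg1 -r0 transversal_eq eq_sym.
exists (\sum_ab U ab); split.
- rewrite /ind_lift linear_sum; apply/matrixP => i j; rewrite mxalg_sumE.
  rewrite (bigD1 (i, j)) //= big1 ?addr0 => [|[a b] neab].
    by rewrite -/(ind_lift d K (U (i, j))) UE mxE !eqxx.
  rewrite -/(ind_lift d K (U (a, b))) UE mxE /=.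
  case: ifP => // /andP[/eqP ia /eqP jb].
  by rewrite ia jb eqxx in neab.
- move=> d' L sLH cycHL iL neLK; rewrite /ind_lift linear_sum big1 //= => ab _.
  have nLH : (L <| H)%g by rewrite -sub_abelian_normal.
  have [_ lM'] := galg_lift_monoid (ind_mx_rep nLH cycHL iL).
  rewrite !lM'; set z := (X in _ * X * _).
  have -> : z = 0; last by rewrite mulr0 mul0r.
  apply/matrixP => i j; rewrite /z [LHS]ind_lift_incl mxE; case: ifP => // _.
  exact: (liftM _ _ _ _ sLH cycHL iL (rG i) (neLK _ (rG i))).
rewrite /galg_quo linear_sum big1 //= => ab _.
have [_ qM] := galg_lift_monoid (galg_quo_rep nNG).
rewrite !qM; set z := (X in _ * X * _).
have -> : z = 0; last by rewrite mulr0 mul0r.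
have sub_rep : multiplicative_rep (fun x : subg_of H =>
    galg_elt rat (subg (G / N)%G (coset N (sgval x)))).
  have [q1 qM'] := galg_quo_rep nNG.
  have GH (x : subg_of H) := subsetP sHG _ (subgP x).
  split=> [|x y]; first by rewrite /= morph1 morph1.
  by have := qM' (subg G (sgval x)) (subg G (sgval y)); rewrite /= !subgK.
rewrite (_ : z = galg_lift (fun x : subg_of H =>
    galg_elt rat (subg (G / N)%G (coset N (sgval x)))) (w ab * e)); last first.
  rewrite /z /galg_incl galg_lift_comp; apply: eq_bigr => x _.
  by rewrite subgK ?(subsetP sHG) ?subgP.
rewrite (galg_lift_monoid sub_rep).2 [X in _ * X]eN ?mulr0 // => x.
by rewrite mem_subg_pre => Nx; rewrite coset_id // morph1.
Qed.

(** * Injectivity *)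

(** 'chi_i vanishes outside H, so this sum extends 'chi_i by zero to G and then
    linearly to QG. *)
Definition irr_sum (i : Iirr H) (u : group_alg rat (subg_of G)) : algC :=
  \sum_x ratr (u x) * 'chi_i (sgval x).

Lemma irr_sum_conj i u s : s \in G ->
  irr_sum (conjg_Iirr i s)
    (galg_elt rat (subg G s^-1%g) * u * galg_elt rat (subg G s)) = irr_sum i u.
Proof.
move=> Gs; rewrite /irr_sum (reindex_inj (conjg_inj (subg G s))).
apply: eq_bigr => x _.
rewrite galg_mul_eltE galg_elt_mulE conjg_IirrE cfConjgE.
  congr (ratr (u _) * 'chi_i _).
    apply: val_inj; rewrite /= !subgK ?groupV //.
    by rewrite invgK !mulgA mulgV mul1g mulgK.
  by rewrite -[RHS](conjgK s); congr (_ ^ _)%g; rewrite /= subgK.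
exact: subsetP (normal_norm nHG) s Gs.
Qed.

(** 'chi_i factors through H / N, and its factor extended by zero to G / N gives
    the same value on the image of u in Q(G/N). *)
Lemma irr_sum_quo (N : {group gT}) i u : (N <| G)%g -> N \subset H ->
  N \subset cfker 'chi_i -> galg_quo N u = 0 -> irr_sum i u = 0.
Proof.
move=> nNG sNH sNi u0; have nNH := normalS sNH sHG nNG.
pose th z := ('chi_i / N)%CF z.
have thE (x : subg_of G) : 'chi_i (sgval x) = th (coset N (sgval x)).
  have [Hx | H'x] := boolP (sgval x \in H); first by rewrite /th cfQuoE.
  rewrite cfun0 // /th cfun0 //; apply: contra H'x => Hx.
  rewrite -{1}(quotientGK nNH); apply/morphpreP; split=> //.
  by rewrite (subsetP (normal_norm nNG)) ?subgP.
have <- : \sum_z ratr ((galg_quo N u) z) * th (sgval z) = irr_sum i u.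
  under eq_bigr => z _ do rewrite sum_ffunE rmorph_sum mulr_suml.
  rewrite exchange_big; apply: eq_bigr => x _ /=; rewrite thE.
  have Gx : coset N (sgval x) \in (G / N)%g by rewrite mem_quotient ?subgP.
  rewrite (bigD1 (subg (G / N)%G (coset N (sgval x)))) //= !ffunE eqxx.
  rewrite [X in _ + X]big1 ?addr0 => [|z /negPf ne].
    by rewrite subgK ?[_ *: 1]mulr1.
  by rewrite !ffunE ne [_ *: 0]mulr0 rmorph0 mul0r.
by rewrite u0 big1 // => z _; rewrite ffunE rmorph0 mul0r.
Qed.

(** As r ord0 = 1, the entry (0, 0) of the induced representation is the
    character of kernel K extended by zero outside H. *)
Lemma irr_sum_ind d (K : {group gT}) i u :
  K \subset H -> cyclic (H / K)%g -> #|H : K|%g = d ->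
  cfker 'chi_i = K -> ind_lift d K u = 0 -> irr_sum i u = 0.
Proof.
move=> sKH cycHK iK keri u0.
have nKH : (K <| H)%g by rewrite -sub_abelian_normal.
pose w : group_alg rat (subg_of H) := [ffun x => u (subg G (sgval x))].
have w0 : ker_char_lift d K w = 0.
  transitivity (ind_lift d K u ord0 ord0); last by rewrite u0 mxE.
  rewrite mxalg_sumE.
  pose F x := u (subg G x) *: ind_mx d K x ord0 ord0.
  rewrite (eq_bigr (fun x => F (sgval x))) => [|x _]; last first.
    by rewrite /F sgvalK mxalgZE.
  rewrite sum_subg (big_setID H) /= (setIidPr sHG) [X in _ = _ + X]big1 ?addr0.
    rewrite -(sum_subg H); apply: eq_bigr => x _.
    by rewrite /F !mxE r0 mul1g invg1 mulg1 subgP ffunE.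
  move=> x /setDP[_ H'x]; rewrite /F mxE r0 mul1g invg1 mulg1 (negPf H'x).
  exact: scaler0.
rewrite -[RHS](ker_char_lift_irr nKH cycHK iK abH keri w0).
pose F x := ratr (u (subg G x)) * 'chi_i x.
rewrite /irr_sum (eq_bigr (fun x => F (sgval x))) => [|x _]; last first.
  by rewrite /F sgvalK.
rewrite sum_subg (big_setID H) /= (setIidPr sHG) [X in _ + X]big1 ?addr0.
  by rewrite -(sum_subg H); apply: eq_bigr => x _; rewrite /F ffunE.
by move=> x /setDP[_ H'x]; rewrite /F cfun0 ?mulr0.
Qed.

(** The sum of all the irreducible characters of the abelian group H is its
    regular character. *)
Lemma irr_sum_eq0 u : (forall i, irr_sum i u = 0) -> u 1%g = 0.
Proof.
move=> u0.
have : \sum_(i : Iirr H) irr_sum i u = #|H|%:R * ratr (u 1%g).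
  have regE x : \sum_(i : Iirr H) 'chi_i x = #|H|%:R *+ (x == 1%g).
    rewrite -cfRegE cfReg_sum sum_cfunE; apply: eq_bigr => i _.
    by rewrite cfunE lin_char1 ?mul1r //; apply/char_abelianP.
  rewrite exchange_big (bigD1 1%g) //= [X in _ + X]big1 ?addr0 => [|x ne1].
    by rewrite -mulr_sumr regE eqxx mulr1n mulrC.
  rewrite -mulr_sumr regE (_ : (sgval x == 1%g) = false) ?mulr0n ?mulr0 //.
  by apply: contraNF ne1 => /eqP x1; apply/eqP/val_inj.
rewrite big1 // => /esym/eqP; rewrite mulf_eq0 (negPf (neq0CG H)) /= fmorph_eq0.
by move/eqP.
Qed.

(** The kernels of the maps that vanish at u are two-sided ideals.  So right
    translation reduces the claim to the coefficient at 1, and conjugation by x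
    replaces 'chi_i by a character of kernel K. *)
Lemma ind_lift_inj (N : {group gT}) u :
    (N <| G)%g -> N \subset H -> galg_quo N u = 0 ->
    (forall i : Iirr H, ~~ (N \subset cfker 'chi_i) ->
       exists d (K : {group gT}) x,
       [/\ x \in G, (cfker 'chi_i :^ x = K)%g, #|H : K|%g = d
         & ind_lift d K u = 0]) ->
  u = 0.
Proof.
move=> nNG sNH u0 uK; apply/ffunP => g; rewrite [RHS]ffunE.
have -> : u g = (u * galg_elt rat g^-1%g) 1%g.
  by rewrite galg_mul_eltE invgK mul1g.
apply: irr_sum_eq0 => i; have [sNi | notN] := boolP (N \subset cfker 'chi_i).
  apply: (irr_sum_quo nNG) => //.
  by rewrite [LHS](galg_lift_monoid (galg_quo_rep nNG)).2 [X in X * _]u0 mul0r.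
have [d [K [x [Gx defK iK uK0]]]] := uK i notN.
have nHx := subsetP (normal_norm nHG) x Gx.
have kerK : cfker 'chi_(conjg_Iirr i x) = K by rewrite conjg_IirrE cfker_conjg.
have sKH : K \subset H by rewrite -kerK cfker_sub.
have cycK : cyclic (H / K)%g by rewrite -kerK cyclic_quo_cfker.
have nKH : (K <| H)%g by rewrite -sub_abelian_normal.
rewrite -(irr_sum_conj _ _ Gx); apply: (irr_sum_ind sKH cycK iK kerK).
rewrite /ind_lift !(galg_lift_monoid (ind_mx_rep nKH cycK iK)).2.
by rewrite [X in _ * (X * _) * _]uK0 mul0r mulr0 mul0r.
Qed.

End InducedRepresentation.

(** * The decomposition *)

Section AlgebraMaps.
Import GRing.Theory.
Local Open Scope ring_scope.
Variable R : pzRingType.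

Definition alg_hom (A B : algType R) (f : A -> B) :=
  linear f /\ monoid_morphism f.

Lemma alg_isomorphic_of_hom (A B : algType R) (f : A -> B) :
  alg_hom f -> (forall u, f u = 0 -> u = 0) -> (forall v, exists u, f u = v) ->
  alg_isomorphic A B.
Proof.
move=> [f_lin f_mon] f_inj f_surj.
pose addf := GRing.isLinear.Build R A B _ f f_lin.
pose mulf := GRing.isMonoidMorphism.Build A B f f_mon.
pose g : {lrmorphism A -> B} := HB.pack f addf mulf.
have surj v : exists u, f u == v by have [u <-] := f_surj v; exists u.
pose h v := xchoose (surj v).
exists g; exists h => [u | v]; last by apply/eqP; apply: (xchooseP (surj v)).
have /eqP fhu := xchooseP (surj (f u)).
apply/eqP; rewrite -subr_eq0; apply/eqP/f_inj.
by rewrite -[f]/(g : _ -> _) raddfB /= fhu subrr.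
Qed.

Definition oplus_pair (X B : algType R) (I : finType) (A : I -> algType R)
    (f : X -> B) (g : forall i, X -> A i) (u : X) : oplus B A :=
  (f u, [ffun i => g i u] : dirsum A).

Lemma oplus_pair_hom (X B : algType R) (I : finType) (A : I -> algType R)
    (f : X -> B) (g : forall i, X -> A i) :
  alg_hom f -> (forall i, alg_hom (g i)) -> alg_hom (oplus_pair f g).
Proof.
move=> [f_lin [f1 fM]] g_hom; split; [|split].
- move=> k u v; congr (_, _); first exact: f_lin.
  by apply/ffunP => i; rewrite !ffunE (g_hom i).1.
- congr (_, _); first exact: f1.
  by apply/ffunP => i; rewrite !ffunE (g_hom i).2.1.
move=> u v; congr (_, _); first exact: fM.
by apply/ffunP => i; rewrite !ffunE (g_hom i).2.2.
Qed.

End AlgebraMaps.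

Lemma galg_lift_hom (R : comNzRingType) (gT : finGroupType) (A : algType R)
    (rho : gT -> A) : multiplicative_rep rho -> alg_hom (galg_lift rho).
Proof.
by move=> rhoP; split; [exact: galg_lift_is_linear | exact: galg_lift_monoid].
Qed.

Section Decomposition.
Import GRing.Theory.
Local Open Scope ring_scope.

Variables (p : nat) (gT : finGroupType) (G H : {group gT}).
Hypotheses (p_prime : prime p) (p_odd : odd p) (pG : (p.-group G)%g).
Hypotheses (oG : #|G| = (p ^ 4)%N) (clG : nil_class G = 3).
Hypotheses (sHG : H \subset G) (abH : abelian H) (iH : #|G : H|%g = p).

Let nHG : (H <| G)%g := max_normal p_prime pG sHG iH.

(** The powers t ^+ a with a < p, where t generates G modulo H. *)
Lemma ex_power_transversal : exists r : 'I_p.-1.+1 -> gT,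
  [/\ forall a, r a \in G, r ord0 = 1%g
    & forall x, x \in G ->
        exists b, forall c, (x * (r c)^-1 \in H)%g = (c == b)].
Proof.
have /cyclicP[z defGH] := cyclic_quo_max p_prime pG sHG iH.
have /morphimP[t nHt Gt def_z] : z \in (G / H)%g by rewrite defGH cycle_id.
have oz : #[z]%g = p by rewrite orderE -defGH card_quotient ?normal_norm.
exists (fun a => t ^+ a)%g; split=> // [a | x Gx]; first by rewrite groupX.
have /cyclePmin[b lt_b def_x] : coset H x \in <[z]>%g.
  by rewrite -defGH mem_quotient.
have p1 := prednK (prime_gt0 p_prime).
have lt_bp : (b < p.-1.+1)%N by rewrite p1 -oz.
exists (Ordinal lt_bp) => c.
have nHx := subsetP (normal_norm nHG) x Gx.
have nHtc : (t ^+ c)%g \in 'N(H)%g by rewrite groupX.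
have -> : (x * (t ^+ c)^-1 \in H)%g = (coset H x == coset H (t ^+ c)%g).
  rewrite -mem_rcoset; apply/idP/eqP => [|eqx].
    by move/(rcoset_kercosetP nHx nHtc).
  exact/(rcoset_kercosetP nHx nHtc).
have lt_cp : (c < p)%N by rewrite -[X in (_ < X)%N]p1.
have lt_bp' : (b < p)%N by rewrite -oz.
rewrite def_x morphX // -[coset_morphism H t]/(coset H t) -def_z.
by rewrite eq_expg_mod_order oz !modn_small // eq_sym.
Qed.

Lemma moved_kernel_data d K : K \in moved_kernels G H d ->
  [/\ K \subset H, cyclic (H / K)%g, #|H : K|%g = d & ~~ (G^`(1)%g \subset K)].
Proof. by rewrite inE => /and4P[? ? /eqP ? ?]. Qed.

Definition nth_kernel d j : {group gT} := nth 1%G (enum (kernel_reps G H d)) j.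

Lemma nth_kernel_rep d j : (j < #|kernel_reps G H d|)%N ->
  nth_kernel d j \in kernel_reps G H d.
Proof. by move=> lt_j; rewrite -mem_enum mem_nth -?cardE. Qed.

Section Family.
(** The index set of the summands M_p(Q(zeta_d)) with d in s and multiplicities
    c d; the pair (d, j) stands for the class of the j-th chosen kernel. *)
Variables (s : seq nat) (c : nat -> nat).
Hypothesis c_reps : {in s, forall d, c d = #|kernel_reps G H d|}.
Local Notation I := {d : seq_sub s & 'I_(c (ssval d))}.
Definition kernel_of (i : I) := nth_kernel (ssval (tag i)) (tagged i).

Lemma kernel_of_rep i : kernel_of i \in kernel_reps G H (ssval (tag i)).
Proof. by apply: nth_kernel_rep; rewrite -c_reps ?ssvalP ?ltn_ord. Qed.

Lemma kernel_of_data i : [/\ kernel_of i \subset H, cyclic (H / kernel_of i)%g,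
  #|H : kernel_of i|%g = ssval (tag i) & ~~ (G^`(1)%g \subset kernel_of i)].
Proof.
apply: moved_kernel_data.
exact: (kernel_reps_mem p_prime pG sHG abH iH (kernel_of_rep i)).
Qed.

Lemma kernel_of_inj : injective kernel_of.
Proof.
move=> i i' eqK; have [_ _ di _] := kernel_of_data i.
have [_ _ di' _] := kernel_of_data i'.
case: i i' eqK di di' => x j [x' j'] /= eqK di di'.
have eqx : x = x' by apply: val_inj; rewrite /= -di -di' eqK.
rewrite {}eqx in j eqK di *.
congr (Tagged _ _); apply: val_inj; apply/eqP => /=.
set X := kernel_reps G H (ssval x').
have cE : #|X| = c (ssval x') by rewrite c_reps ?ssvalP.
rewrite -(nth_uniq 1%G _ _ (enum_uniq X)) -?cardE ?cE ?ltn_ord //.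
exact/eqP.
Qed.

Lemma kernel_of_ex d K : d \in s -> K \in kernel_reps G H d ->
  exists2 i : I, ssval (tag i) = d & kernel_of i = K.
Proof.
move=> sd XK; pose x := SeqSub sd.
have lt_j : (index K (enum (kernel_reps G H d)) < c (ssval x))%N.
  by rewrite /= c_reps // cardE index_mem mem_enum.
exists (Tagged (fun x : seq_sub s => 'I_(c (ssval x))) (Ordinal lt_j)) => //.
by rewrite /kernel_of /nth_kernel /= nth_index ?mem_enum.
Qed.

End Family.

Variable r : 'I_p.-1.+1 -> gT.
Hypotheses (rG : forall a, r a \in G) (r0 : r ord0 = 1%g).
Hypothesis rP : forall x, x \in G ->
  exists b, forall c, (x * (r c)^-1 \in H)%g = (c == b).

Let sDH := der1_sub_max p_prime pG sHG iH.
Let nDG : (G^`(1) <| G)%g := der_normal 1 G.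

(** The index of a kernel K in H is the d for which K occurs, so that kernels
    at distinct places of the family are not conjugate in G, and the preimages
    provided by [ind_lift_isolate] can be added up. *)
Lemma family_surj s c (c_reps : {in s, forall d, c d = #|kernel_reps G H d|})
    (m : forall i : {d : seq_sub s & 'I_(c (ssval d))},
       mxalg (Qzeta (ssval (tag i))) p) :
  exists u : group_alg rat (subg_of G),
  [/\ galg_quo G^`(1)%G u = 0,
      forall i, ind_lift H r (ssval (tag i)) (kernel_of i) u = m i
    & forall d L, L \in kernel_reps G H d -> d \notin s ->
        ind_lift H r d L u = 0].
Proof.
have reps_data d L : L \in kernel_reps G H d -> _ :=
  fun XL => moved_kernel_data (kernel_reps_mem p_prime pG sHG abH iH XL).
have apart d d' (L K : {group gT}) x : K \in kernel_reps G H d ->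
    L \in kernel_reps G H d' -> x \in G -> (L :^ x)%G = K -> d = d' /\ L = K.
  move=> XK XL Gx defK.
  have [_ _ iK _] := reps_data _ _ XK; have [_ _ iL _] := reps_data _ _ XL.
  have eqd : d = d'.
    have nHx := subsetP (normal_norm nHG) x Gx.
    by rewrite -iK -iL -defK /= -{1}(normP nHx) indexJg.
  split=> //; apply: (kernel_reps_inj p_prime pG sHG abH iH _ XK Gx) => //.
  by rewrite eqd.
have /fin_all_exists[u uP] (i : {d : seq_sub s & 'I_(c (ssval d))}) :
    exists u : group_alg rat (subg_of G),
  [/\ ind_lift H r (ssval (tag i)) (kernel_of i) u = m i,
      forall d' L, L \in kernel_reps G H d' -> L != kernel_of i ->
        ind_lift H r d' L u = 0
    & galg_quo G^`(1)%G u = 0].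
  have [sKH cycK iK notD] := kernel_of_data c_reps i.
  have XK := kernel_of_rep c_reps i.
  have MK := kernel_reps_mem p_prime pG sHG abH iH XK.
  have [|u [uK uL uQ]] := ind_lift_isolate sHG abH nHG rG r0 rP (m i) nDG sDH
    sKH cycK iK notD.
    move=> x Gx H'x; apply: contra H'x => /eqP eqK.
    rewrite -(norm_moved_kernel p_prime p_odd pG oG clG sHG abH iH MK) inE Gx /=.
    by apply/normP; rewrite -[in RHS]eqK.
  exists u; split=> // d' L XL neLK.
  have [sLH cycL iL _] := reps_data _ _ XL.
  apply: uL => // x Gx; apply: contra neLK => /eqP defK.
  by have [_ ->] := apart _ _ _ _ _ XK XL Gx defK.
exists (\sum_i u i); split.
- rewrite /galg_quo linear_sum big1 // => i _; by have [] := uP i.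
- move=> i; rewrite /ind_lift linear_sum (bigD1 i) //= [X in _ + X]big1 ?addr0.
    by have [] := uP i.
  move=> j neij; have [_ uj _] := uP j; apply: uj; first exact: kernel_of_rep.
  by apply: contra neij => /eqP/(kernel_of_inj c_reps)->.
move=> d L XL s'd; rewrite /ind_lift linear_sum big1 // => i _.
have [_ ui _] := uP i; apply: ui => //; apply: contra s'd => /eqP eqL.
have [_ _ iL _] := reps_data _ _ XL.
have [_ _ iK _] := kernel_of_data c_reps i.
by rewrite -iL eqL iK ssvalP.
Qed.

(** The orders d of the kernels are distributed over two lists so as to match
    the two sums of the decomposition, over the d that divide the exponent of
    H / G^`(1) and over those that do not. *)
Section TwoFamilies.
Variables (s1 s2 : seq nat) (c1 c2 : nat -> nat).
Hypothesis c1_reps : {in s1, forall d, c1 d = #|kernel_reps G H d|}.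
Hypothesis c2_reps : {in s2, forall d, c2 d = #|kernel_reps G H d|}.
Hypothesis s12 : {in s1, forall d, d \notin s2}.
Hypothesis s_all : forall d, (d %| exponent H)%N -> (d \in s1) || (d \in s2).

Lemma group_alg_decomposition : alg_isomorphic (group_alg rat (subg_of G))
  (oplus_copies
    (oplus_copies (group_alg rat (subg_of (G / G^`(1))%G)) s1 c1
       (fun d => mxalg (Qzeta d) p))
    s2 c2 (fun d => mxalg (Qzeta d) p)).
Proof.
pose th s c (i : {d : seq_sub s & 'I_(c (ssval d))}) :=
  ind_lift H r (ssval (tag i)) (kernel_of i)
    : group_alg rat (subg_of G) -> mxalg (Qzeta (ssval (tag i))) p.
have th_hom s c (c_reps : {in s, forall d, c d = #|kernel_reps G H d|})
    (i : {d : seq_sub s & 'I_(c (ssval d))}) : alg_hom (th s c i).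
  have [sKH cycK iK _] := kernel_of_data c_reps i.
  apply: galg_lift_hom; apply: (ind_mx_rep rG rP) => //.
  by rewrite -sub_abelian_normal.
have quo_hom := galg_lift_hom (galg_quo_rep nDG).
apply: (alg_isomorphic_of_hom (f :=
  oplus_pair (oplus_pair (galg_quo G^`(1)%G) (th s1 c1)) (th s2 c2))).
- apply: oplus_pair_hom => [|i]; last exact: th_hom.
  by apply: oplus_pair_hom => [|i]; [exact: quo_hom | exact: th_hom].
- move=> u [quo0 /ffunP th1 /ffunP th2].
  apply: (ind_lift_inj sHG abH nHG rG r0 rP nDG sDH quo0) => i notD.
  pose d := #|H : cfker 'chi_i|%g; pose K0 := cfker_group 'chi_i.
  have cycK0 : cyclic (H / cfker 'chi_i)%g := cyclic_quo_cfker i abH.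
  have oHK : #|H / cfker 'chi_i|%g = d.
    by rewrite card_quotient ?normal_norm ?cfker_normal.
  have MK0 : K0 \in moved_kernels G H d by rewrite inE cfker_sub cycK0 eqxx notD.
  have [x Gx XK] := kernel_reps_ex p_prime pG sHG abH iH MK0.
  have dv_d : (d %| exponent H)%N.
    by rewrite -oHK -exponent_cyclic ?exponent_quotient.
  have [_ _ iK _] :=
    moved_kernel_data (kernel_reps_mem p_prime pG sHG abH iH XK).
  exists d, (K0 :^ x)%G, x; split=> //.
  case/orP: (s_all dv_d) => sd.
    have [j <- <-] := kernel_of_ex c1_reps sd XK.
    by have := th1 j; rewrite !ffunE.
  have [j <- <-] := kernel_of_ex c2_reps sd XK.
  by have := th2 j; rewrite !ffunE.
move=> [[b /= m1] m2].
have [u0 u0b] : exists u, galg_quo G^`(1)%G u = b.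
  exists (galg_lift (fun z : subg_of (G / G^`(1))%G =>
    galg_elt rat (subg G (repr (sgval z)))) b).
  rewrite /galg_quo galg_lift_comp [RHS]galg_sum_elt; apply: eq_bigr => z _.
  have Gz : repr (sgval z) \in G.
    rewrite -(quotientGK nDG); apply/morphpreP; split; first exact: repr_coset_norm.
    by rewrite /= coset_reprK subgP.
  by rewrite subgK // coset_reprK sgvalK.
(* The lift u0 of b is corrected on each family of matrix components. *)
have [u1 [q1 v1 w1]] := family_surj c1_reps (fun i => m1 i - th s1 c1 i u0).
have [u2 [q2 v2 w2]] := family_surj c2_reps (fun i => m2 i - th s2 c2 i u0).
have thD s c i u v w : th s c i (u + v + w) = th s c i u + th s c i v + th s c i w.
  by rewrite /th /ind_lift !linearD.
exists (u0 + u1 + u2); congr (_, _, _).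
- rewrite /galg_quo !linearD /= [X in X + _ + _]u0b [X in _ + X + _]q1.
  by rewrite [X in _ + X]q2 !addr0.
- apply/ffunP => i; rewrite ffunE thD [X in _ + X + _]v1 [X in _ + X]w2.
  - by rewrite addr0 subrKC.
  - exact: kernel_of_rep.
  by rewrite s12 ?ssvalP.
apply/ffunP => i; rewrite ffunE thD [X in _ + X + _]w1 ?[X in _ + X]v2.
- by rewrite addr0 subrKC.
- exact: kernel_of_rep.
by apply: contraL (ssvalP (tag i)) => /s12.
Qed.

End TwoFamilies.
End Decomposition.

Lemma num_cyclic_eq0 (gT : finGroupType) (H : {group gT}) d :
  ~~ (d %| exponent H) -> num_cyclic H d = 0.
Proof.
move=> not_dv; apply: eq_card0 => C; rewrite !inE.
apply/and3P => -[sCH cycC /eqP oC]; case/negP: not_dv.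
by rewrite -oC -(exponent_cyclic cycC) exponentS.
Qed.

Theorem theorem3 (p : nat) (gT : finGroupType) (G H : {group gT})
    (p_prime : prime p) (p_odd : odd p)
    (pG : (p.-group G)%g) (nabG : ~~ abelian G)
    (oG : #|G| = (p ^ 4)%N) (clG : nil_class G = 3)
    (sHG : H \subset G) (abH : abelian H) (iH : #|G : H|%g = p) :
  let m := exponent H in
  let m' := exponent (H / G^`(1))%g in
  let a := num_cyclic H in
  let a' := num_cyclic (H / G^`(1))%G in
  (* the multiplicities are nonnegative integers: the quotients and the
     subtraction in nat below are exact *)
  [/\ forall d, d %| m -> ~~ (d %| m') -> p %| a d,
      forall d, d %| m -> d %| m' -> a' d <= a d /\ p %| a d - a' d
    & alg_isomorphic (group_alg rat (subg_of G))
        (oplus_copies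
          (oplus_copies (group_alg rat (subg_of (G / G^`(1))%G))
            [seq d <- divisors m | ~~ (d %| m')] (fun d => a d %/ p)
            (fun d => mxalg (Qzeta d) p))
          [seq d <- divisors m | d %| m'] (fun d => (a d - a' d) %/ p)
          (fun d => mxalg (Qzeta d) p))].
Proof.
move=> m m' a a'.
have p_gt0 := prime_gt0 p_prime.
have aE d : a d = #|kernel_reps G H d| * p + a' d.
  rewrite -(card_kernel_reps p_prime p_odd pG oG clG sHG abH iH).
  by rewrite [LHS](esym (card_moved_kernels p_prime pG sHG abH iH d)).
have a'0 d : ~~ (d %| m') -> a' d = 0 by apply: num_cyclic_eq0.
have [r [rG r0 rP]] := ex_power_transversal p_prime pG sHG iH.
split=> [d _ /a'0 a'd | d _ _ |].
- by rewrite aE a'd addn0 dvdn_mull.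
- by rewrite aE addnK leq_addl dvdn_mull.
apply: (group_alg_decomposition p_prime p_odd pG oG clG sHG abH iH rG r0 rP).
- move=> d; rewrite mem_filter => /andP[/a'0 a'd _].
  by rewrite aE a'd addn0 mulnK.
- by move=> d _; rewrite aE addnK mulnK.
- by move=> d; rewrite !mem_filter => /andP[/negPf->].
move=> d dv_d; rewrite !mem_filter -dvdn_divisors ?exponent_gt0 // -/m dv_d !andbT.
by rewrite orNb.
Qed.
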